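(* Let $f$ be a spectral density on $\Lambda$ such that $\overline{E_f}$ is the union of finitely many closed arcs of $\mathbb T$ and $f>0$ almost everywhere on $\{\lambda:e^{i\lambda}\in\overline{E_f}\}$. If the sequence $|v_n(f)|$ of moduli of the Verblunsky coefficients of $f$ converges, then $$\lim_{n\to\infty}|v_n(f)|=\sqrt{1-\tau(\overline{E_f})^2}.$$
   Context: $\Lambda=[-\pi,\pi]$, $\mathbb T$ the unit circle, $z=e^{i\lambda}$. A spectral density is $f\ge0$, $f\in L^1(\Lambda)$, positive on a set of positive measure. $E_f=\{e^{i\lambda}:f(\lambda)>0\}$ and $\overline{E_f}$ its closure. Verblunsky coefficients: let $\mu$ be the probability measure on $\mathbb T$ with density proportional to $f$, let $p_n(z)=z^n+\dots$ be the monic polynomials orthogonal in $L^2(\mathbb T,\mu)$; then $v_n(f):=-\overline{p_n(0)}$, $n\in\mathbb N$ (they satisfy $|v_n|<1$ and $p_{n+1}(z)=zp_n(z)-\overline{v_{n+1}}z^n\overline{p_n(1/\bar z)}$). Transfinite diameter: for compact $F\subset\mathbb C$, $\tau(F)=\lim_{n\to\infty}\max_{z_1,\dots,z_n\in F}\big(\prod_{1\le j<k\le n}|z_j-z_k|\big)^{2/(n(n-1))}$. *)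

(* Defs.v *)
From HB Require Import structures.
From mathcomp Require Import all_boot all_order all_algebra.
From mathcomp Require Import all_classical all_reals all_analysis.
From mathcomp Require Import complex.
Set Implicit Arguments. Unset Strict Implicit. Unset Printing Implicit Defensive.
Import Order.TTheory GRing.Theory Num.Theory ComplexField.
Import numFieldNormedType.Exports.
Local Open Scope classical_set_scope.
Local Open Scope ring_scope.

Section Defs.
Variable R : realType.

Definition expi (x : R) : R[i] := (cos x +i* sin x)%C.

Definition cabs (z : R[i]) : R := Normc.normc z.

Definition Lam : set R := `[(- pi), pi].

Notation mu := (@lebesgue_measure R).

Definition spectral_density (f : R -> R) : Prop :=
  (forall x, Lam x -> 0 <= f x) /\
  mu.-integrable Lam (EFin \o f) /\
  (0 < mu [set x | Lam x /\ (0 < f x)%R])%E.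

Definition Ef (f : R -> R) : set R[i] := [set expi x | x in [set x | Lam x /\ 0 < f x]].

Definition clEf (f : R -> R) : set R[i] :=
  [set z | forall e : R, 0 < e -> exists2 w, Ef f w & cabs (z - w) < e].

Definition closed_arc (a b : R) : set R[i] := [set expi t | t in `[a, b]].

Definition finite_union_closed_arcs (F : set R[i]) : Prop :=
  exists s : seq (R * R),
    (forall ab, ab \in s -> ab.1 < ab.2 <= ab.1 + 2 * pi) /\
    F = \bigcup_(ab in [set ab | ab \in s]) closed_arc ab.1 ab.2.

Definition cintegral (g : R -> R[i]) : R[i] :=
  (Rintegral mu Lam (fun x => complex.Re (g x)) +i* Rintegral mu Lam (fun x => complex.Im (g x)))%C.

Definition is_monic_OP (f : R -> R) (n : nat) (p : {poly R[i]}) : Prop :=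
  p \is monic /\ size p = n.+1 /\
  forall k : nat, (k < n)%N ->
    cintegral (fun x => p.[expi x] * conjc (expi x ^+ k) * (f x)%:C%C) = 0.

Definition monic_OP (f : R -> R) (n : nat) : {poly R[i]} :=
  xget 0 [set p | is_monic_OP f n p].

Definition verblunsky (f : R -> R) (n : nat) : R[i] :=
  - conjc (monic_OP f n).[0].

Definition diam_n (F : set R[i]) (n : nat) : R :=
  sup [set (\prod_(j < n) \prod_(k < n | (j < k)%N) cabs (z j - z k))
             `^ (2 / (n * n.-1)%:R)
      | z in [set z : 'I_n -> R[i] | forall i, F (z i)]].

Definition transfinite_diameter (F : set R[i]) : R :=
  lim (diam_n F n @[n --> \oo]).

End Defs.

(* Main.v *)
Require Import Defs.
From HB Require Import structures.
From mathcomp Require Import all_boot all_order all_algebra.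
From mathcomp Require Import all_classical all_reals all_analysis.
From mathcomp Require Import complex.
From mathcomp Require Import perm measurable_realfun ring lra.
Import Order.TTheory GRing.Theory Num.Theory ComplexField.
Import numFieldNormedType.Exports.
Local Open Scope classical_set_scope.
Local Open Scope ring_scope.

(** Let [Phi_n] be the monic orthogonal polynomials and [W_n = ||Phi_n||^2]. Szego's
recursion gives [W_(n+1) = W_n (1 - |v_(n+1)|^2)], so if [|v_n| -> L] then
[W_0 ... W_(n-1)] is [(1 - L^2)^(n(n-1)/2)] up to factors [exp (o(n^2))]. It remains to
compare this product with the maximum of the squared Vandermonde product over the closure [F]
of [E_f].

Lower bound: [Phi_n] minimizes the norm among monic polynomials of degree [n], hence a
monic polynomial with zeros [z_0, ..., z_(n-1)] satisfies [|q(w)|^2 >= W_n / (2 W_0)] at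
some [w] in [E_f]; choosing such points greedily bounds the maximum from below.

Upper bound: the Vandermonde determinant is [det (Phi_k (z_j))], at most [n!] times the product of
the suprema of the [|Phi_k|] on [F]. Since [f > 0] a.e. on [F], a weak Remez inequality
[sup_F |P|^2 <= C c^n ||P||^2], valid for every [c > 1], compares these with the [W_k].
Its proof interpolates [P] at the points of a good set, where [f >= eta] and [|P|] is
bounded by its norm, that cut off from that set the same lengths as Chebyshev nodes. *)

(** The weight has no positive lower bound on [F], so the norm controls [P] only off a set of small
    positive measure. Every point [x0] of [F] has on one side a segment of fixed length inside [F],
    whose bad part can be made as short as desired. The length of the good part of [[0, t]] is
    1-Lipschitz in [t]. Hence points with prescribed good lengths are at least as far apart as these
    lengths, while their distance to [x0] exceeds them by at most the bad length. Interpolation at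
    such points therefore costs no more than extrapolating from Chebyshev nodes in [[-1, 1]] to a
    point [X > 1] with [X - 1] comparable to the bad fraction, and the growth factor
    [X + sqrt (X^2 - 1)] tends to 1 with [X]. A loss [c^k] in each degree [k] multiplies the squared
    Vandermonde product by [c^(n(n-1)/2)], hence the diameter by [sqrt c]. This is why a bound for
    every [c > 1] is enough. *)

(** * Chebyshev polynomials *)

Section Chebyshev.
Context {R : realType}.
Implicit Types (n : nat) (x s a : R).

(* The pair (T_n, U_{n-1}) of Chebyshev polynomials of the two kinds. *)
Fixpoint chebTU n : {poly R} * {poly R} :=
  if n is m.+1 then
    let: (t, u) := chebTU m in ('X * t - (1 - 'X ^+ 2) * u, 'X * u + t)
  else (1, 0).

Definition chebT n := (chebTU n).1.
Definition chebU n := (chebTU n).2.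

Lemma chebTS n : chebT n.+1 = 'X * chebT n - (1 - 'X ^+ 2) * chebU n.
Proof. by rewrite /chebT /chebU /=; case: (chebTU n). Qed.

Lemma chebUS n : chebU n.+1 = 'X * chebU n + chebT n.
Proof. by rewrite /chebT /chebU /=; case: (chebTU n). Qed.

Lemma cheb_cos n a :
  (chebT n).[cos a] = cos (n%:R * a) /\ sin a * (chebU n).[cos a] = sin (n%:R * a).
Proof.
elim: n => [|n [IT IU]].
  by rewrite mul0r cos0 sin0 /chebT /chebU /= hornerE horner0 mulr0.
rewrite chebTS chebUS !hornerE IT -[n.+1%:R]natr1 [(n%:R + 1) * a]mulrDl mul1r cosD sinD -IU.
split; last by ring.
by rewrite -(sin2cos2 a); ring.
Qed.

(** The second identity is carried through the induction because differentiating the recursion of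
    [chebT] produces the term [(1 - X^2) U']. *)
Lemma cheb_deriv n : (chebT n)^`() = n%:R * chebU n /\
  (1 - 'X ^+ 2) * (chebU n)^`() = 'X * chebU n - n%:R * chebT n.
Proof.
elim: n => [|n [IT IU]].
  by rewrite /chebT /chebU /= derivC deriv0; split; ring.
rewrite chebTS chebUS; split.
  rewrite derivB !derivM derivB derivC derivXn derivX /= IT -natr1.
  have -> : (1 - 'X ^+ 2) * (chebU n)^`() = 'X * chebU n - n%:R * chebT n by [].
  by ring.
rewrite derivD derivM derivX IT -natr1 mulrDr mulrDr mul1r.
have -> : (1 - 'X^2) * ('X * (chebU n)^`()) = 'X * ('X * chebU n - n%:R * chebT n).
  by rewrite -IU; ring.
by ring.
Qed.

Lemma size_cheb n : (size (chebT n) <= n.+1)%N /\ (size (chebU n) <= n)%N.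
Proof.
elim: n => [|n [IT IU]]; first by rewrite /chebT /chebU /= size_poly1 size_poly0.
have s2 : (size (1 - 'X^2 : {poly R})%R <= 3)%N.
  by rewrite (leq_trans (size_polyD _ _))// size_polyN size_polyXn size_poly1.
rewrite chebTS chebUS; split.
  rewrite (leq_trans (size_polyD _ _))// geq_max size_polyN.
  apply/andP; split; rewrite (leq_trans (size_polyMleq _ _))//.
    by rewrite size_polyX.
  by rewrite -subn1 leq_subLR (leq_trans (leq_add s2 IU)).
rewrite (leq_trans (size_polyD _ _))// geq_max IT andbT.
by rewrite (leq_trans (size_polyMleq _ _))// size_polyX.
Qed.

Lemma cheb_ge0 n x : 1 <= x -> 0 <= (chebT n).[x] /\ 0 <= (chebU n).[x].
Proof.
move=> x1; elim: n => [|n [IT IU]].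
  by rewrite /chebT /chebU /= hornerE horner0.
rewrite chebTS chebUS !hornerE; split; last by rewrite addr_ge0// mulr_ge0//; lra.
rewrite -mulNr; apply: addr_ge0; apply: mulr_ge0 => //; nra.
Qed.

(** The recursions multiply [T + s U] by [x + s] at each step; the part [s U] is then dropped as
    nonnegative. *)
Lemma chebT_le n x s : 1 <= x -> 0 <= s -> s ^+ 2 = x ^+ 2 - 1 ->
  (chebT n).[x] <= (x + s) ^+ n.
Proof.
move=> x1 s0 s2; suff <- : (chebT n).[x] + s * (chebU n).[x] = (x + s) ^+ n.
  by rewrite lerDl mulr_ge0//; have [] := cheb_ge0 n x x1.
elim: n => [|n IH]; first by rewrite /chebT /chebU /= hornerE horner0 mulr0 addr0.
rewrite chebTS chebUS !hornerE [(x + s) ^+ n.+1]exprS -IH.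
have -> : 1 - x ^+ 2 = - s ^+ 2 by rewrite s2; ring.
by ring.
Qed.

Definition cheb_node N (j : 'I_N) : R := cos ((2 * j%:R + 1) * pi / (2 * N%:R)).

Lemma cheb_angle N (j : 'I_N) :
  0 < ((2 * j%:R + 1) * pi / (2 * N%:R) : R) < pi.
Proof.
have N0 : 0 < N%:R :> R by rewrite ltr0n (leq_trans _ (ltn_ord j)).
have jN : j%:R + 1 <= N%:R :> R by rewrite natr1 ler_nat.
have j0 : 0 <= j%:R :> R by rewrite ler0n.
have p0 := pi_gt0 R.
apply/andP; split; first by rewrite divr_gt0 ?mulr_gt0//; lra.
by rewrite ltr_pdivrMr ?mulr_gt0// mulrC ltr_pM2l//; lra.
Qed.

Lemma cheb_node_inj N : injective (@cheb_node N).
Proof.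
move=> i j /cos_inj; rewrite !in_itv /=.
have /andP[a0 a1] := cheb_angle N i; have /andP[b0 b1] := cheb_angle N j.
rewrite !ltW// => /(_ isT isT).
have N0 : 2 * N%:R != 0 :> R.
  by rewrite mulf_neq0 ?pnatr_eq0 -?lt0n// (leq_trans _ (ltn_ord j)).
move=> /(divIf N0)/(mulIf (lt0r_neq0 (pi_gt0 R)))/addIr/mulfI.
by rewrite pnatr_eq0 => /(_ isT)/eqP; rewrite eqr_nat => /eqP/ord_inj.
Qed.

Lemma cheb_node_le1 N j : -1 < @cheb_node N j < 1.
Proof.
have /andP[a0 a1] := cheb_angle N j; rewrite /cheb_node.
set a := _ / _ in a0 a1 *.
have ia : a \in `[0, pi] by rewrite in_itv /= !ltW.
have := @ltr_cos R a pi ia; rewrite cospi => ->; last by rewrite in_itv /= pi_ge0 lexx.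
have := @ltr_cos R 0 a; rewrite cos0 => -> //; first by rewrite a1 a0.
by rewrite in_itv /= lexx pi_ge0.
Qed.

Lemma chebT_node N j : (chebT N).[@cheb_node N j] = 0.
Proof.
have N0 : N%:R != 0 :> R by rewrite pnatr_eq0 -lt0n (leq_trans _ (ltn_ord j)).
rewrite /cheb_node (cheb_cos N _).1.
have -> : N%:R * ((2 * j%:R + 1) * pi / (2 * N%:R)) = pi / 2 + pi *+ j :> R.
  by rewrite -mulr_natr; field.
by rewrite addrC; elim: (j : nat) => [|m IH];
  rewrite ?mulr0n ?add0r ?cos_pihalf// mulrS -addrA addrC cosDpi IH oppr0.
Qed.

(** At a node [cos (N a) = 0], so [sin a * U (cos a) = sin (N a)] has modulus 1 and [|U| >= 1],
    while [T' = N U]. *)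
Lemma chebT_node_deriv N j : N%:R <= `|(chebT N)^`().[@cheb_node N j]|.
Proof.
rewrite (cheb_deriv N).1 hornerM -polyC_natr hornerC normrM normr_nat.
rewrite ler_peMr// /cheb_node.
set a := _ / _; have [cT sU] := cheb_cos N a.
have : cos (N%:R * a) = 0 by rewrite -cT chebT_node.
move=> /eqP; rewrite -norm_sin_eq1 -sU normrM => /eqP <-.
by rewrite ler_piMl// sin_max.
Qed.

Lemma chebT_factor N : (chebT N) = lead_coef (chebT N) *: \prod_(j < N) ('X - (cheb_node N j)%:P).
Proof.
have T0 : chebT N != 0.
  apply/eqP => T0; have := (cheb_cos N 0).1.
  by rewrite T0 horner0 mulr0 cos0 => /eqP; rewrite eq_sym oner_eq0.
have szle : (size (chebT N) <= N.+1)%N := (size_cheb N).1.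
pose rs := [seq cheb_node N j | j : 'I_N].
have urs : uniq rs by rewrite map_inj_uniq ?enum_uniq//; exact: cheb_node_inj.
have srs : size rs = N by rewrite size_map size_enum_ord.
have rrs : all (root (chebT N)) rs.
  by apply/allP => _ /mapP[j _ ->]; rewrite rootE chebT_node.
have sz : size (chebT N) = (size rs).+1.
  by have := max_poly_roots T0 rrs urs; rewrite srs => h; apply/eqP; rewrite eqn_leq szle h.
have := all_roots_prod_XsubC sz rrs.
rewrite uniq_rootsE => /(_ urs) {1}->; congr (_ *: _).
by rewrite big_map -big_enum.
Qed.

(** The [j]-th product is [|T(x)| / ((x - c_j) |T'(c_j)|)], as the leading coefficient cancels. Here
    [|T'(c_j)| >= N] absorbs the number of terms, and [x - c_j >= x - 1]. *)
Lemma cheb_lagrange N x s : (0 < N)%N -> 1 < x -> 0 <= s -> s ^+ 2 = x ^+ 2 - 1 ->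
  \sum_(j < N) \prod_(k < N | k != j)
     ((x - cheb_node N k) / `|cheb_node N j - cheb_node N k|)
  <= (x + s) ^+ N / (x - 1).
Proof.
move=> N0 x1 s0 s2.
set c := lead_coef (chebT N).
have xk0 k : 0 < x - cheb_node N k by have := cheb_node_le1 N k; lra.
have Tx : (chebT N).[x] = c * \prod_(k < N) (x - cheb_node N k).
  rewrite {1}chebT_factor hornerZ horner_prod; congr (_ * _).
  by apply: eq_bigr => k _; rewrite hornerXsubC.
have Td j : (chebT N)^`().[cheb_node N j] =
    c * \prod_(k < N | k != j) (cheb_node N j - cheb_node N k).
  rewrite {1}chebT_factor derivZ hornerZ (bigD1 j)//= derivM derivXsubC mul1r.
  rewrite hornerD hornerM hornerXsubC subrr mul0r addr0 horner_prod.
  by congr (_ * _); apply: eq_bigr => k _; rewrite hornerXsubC.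
have NR : 0 < N%:R :> R by rewrite ltr0n.
have c0 : 0 < `|c|.
  rewrite normr_gt0; apply/eqP => c0; have := chebT_node_deriv N (Ordinal N0).
  by rewrite Td c0 mul0r normr0 leNgt NR.
have step j : \prod_(k < N | k != j)
     ((x - cheb_node N k) / `|cheb_node N j - cheb_node N k|) <=
     (x + s) ^+ N / (x - 1) / N%:R.
  have dj := chebT_node_deriv N j; rewrite Td normrM normr_prod in dj.
  rewrite prodf_div.
  set A := \prod_(k < N | k != j) (x - _); set B := \prod_(k < N | k != j) `| _ | in dj *.
  have B0 : 0 < B by rewrite -(pmulr_rgt0 _ c0) (lt_le_trans NR).
  have A0 : 0 <= A by apply: prodr_ge0 => k _; apply: ltW.
  have TA : `|(chebT N).[x]| = `|c| * ((x - cheb_node N j) * A).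
    by rewrite Tx (bigD1 j)//= normrM [in X in _ * X]ger0_norm// mulr_ge0// ltW.
  have Tle : `|(chebT N).[x]| <= (x + s) ^+ N.
    by have [T0 _] := cheb_ge0 N x (ltW x1); rewrite ger0_norm // chebT_le // ltW.
  rewrite ler_pdivrMr// mulrAC ler_pdivlMr// mulrAC ler_pdivlMr ?subr_gt0//.
  have h1 : A * (x - 1) <= (x - cheb_node N j) * A.
    by rewrite mulrC ler_wpM2r// lerD2l lerN2; have := cheb_node_le1 N j; lra.
  have h2 : 0 <= A * (x - 1) by rewrite mulr_ge0// subr_ge0 ltW.
  rewrite -(ler_pM2l c0).
  apply: (@le_trans _ _ (`|c| * ((x - cheb_node N j) * A) * N%:R)).
    by rewrite -[leRHS]mulrA ler_wpM2l// [leLHS]mulrAC ler_wpM2r.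
  rewrite -TA; apply: (@le_trans _ _ ((x + s) ^+ N * N%:R)).
    by rewrite ler_wpM2r.
  by rewrite mulrCA ler_wpM2l// exprn_ge0//; lra.
apply: (le_trans (ler_sum _ (fun j _ => step j))).
by rewrite sumr_const card_ord -[leLHS]mulr_natr divfK// gt_eqF.
Qed.

End Chebyshev.

(** * The unit circle *)

Section UnitCircle.
Context {R : realType}.
Implicit Types (x y t : R) (z w : R[i]).

Lemma cabs_ge0 z : 0 <= cabs z.
Proof. by case: z => a b; rewrite /cabs /= sqrtr_ge0. Qed.

Lemma cabsM z w : cabs (z * w) = cabs z * cabs w.
Proof. exact: Normc.normcM. Qed.

Lemma cabsD z w : cabs (z + w) <= cabs z + cabs w.
Proof. exact: le_normcD. Qed.

Lemma cabsN z : cabs (- z) = cabs z.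
Proof. exact: normcN. Qed.

Lemma cabsB z w : cabs (z - w) = cabs (w - z).
Proof. by rewrite -cabsN opprB. Qed.

Lemma cabsV z : cabs z^-1 = (cabs z)^-1.
Proof. exact: Normc.normcV. Qed.

Lemma cabs_eq0 z : (cabs z == 0) = (z == 0).
Proof.
apply/eqP/eqP => [/Normc.eq0_normc //|->].
exact: Normc.normc0.
Qed.

Lemma cabs1 : cabs (1 : R[i]) = 1.
Proof. exact: Normc.normc1. Qed.

Lemma cabs_prod (I : Type) (r : seq I) (P : pred I) (F : I -> R[i]) :
  cabs (\prod_(i <- r | P i) F i) = \prod_(i <- r | P i) cabs (F i).
Proof. by apply: (big_morph _ cabsM cabs1). Qed.

Lemma cabs_sum (I : Type) (r : seq I) (P : pred I) (F : I -> R[i]) :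
  cabs (\sum_(i <- r | P i) F i) <= \sum_(i <- r | P i) cabs (F i).
Proof.
elim/big_rec2: _ => [|i a b _ IH]; first by rewrite /cabs Normc.normc0.
by rewrite (le_trans (cabsD _ _))// lerD2l.
Qed.

Lemma sqr_cabs z : cabs z ^+ 2 = complex.Re z ^+ 2 + complex.Im z ^+ 2.
Proof. by case: z => a b; rewrite /cabs /= sqr_sqrtr// addr_ge0 ?sqr_ge0. Qed.

Lemma mulcJ z : z * conjc z = (cabs z ^+ 2)%:C%C.
Proof. by rewrite sqr_cabs; case: z => a b; simpc; congr Complex; ring. Qed.

Lemma cabs_conj z : cabs (conjc z) = cabs z.
Proof. by case: z => a b; rewrite /cabs /= sqrrN. Qed.

Lemma expiD x y : expi (x + y) = expi x * expi y.
Proof. by rewrite /expi sinD cosD; simpc; congr Complex; ring. Qed.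

Lemma conj_expi x : conjc (expi x) = expi (- x).
Proof. by rewrite /expi sinN cosN. Qed.

Lemma expi0 : expi (0 : R) = 1.
Proof. by rewrite /expi sin0 cos0. Qed.

Lemma expiJ x : expi x * conjc (expi x) = 1.
Proof. by rewrite conj_expi -expiD subrr expi0. Qed.

Lemma cabs_expi x : cabs (expi x) = 1.
Proof. by rewrite /cabs /= cos2Dsin2 sqrtr1. Qed.

Lemma expiD2pi x : expi (x + pi *+ 2) = expi x.
Proof. by rewrite /expi cosD2pi sinD2pi. Qed.

Lemma chord x y : cabs (expi x - expi y) = 2 * `|sin ((x - y) / 2)|.
Proof.
have h : cos (x - y) = 1 - 2 * sin ((x - y) / 2) ^+ 2.
  by rewrite {1}(splitr (x - y)) cosD -!expr2 cos2sin2; ring.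
rewrite cosB in h.
have e : cabs (expi x - expi y) ^+ 2 = (2 * `|sin ((x - y) / 2)|) ^+ 2.
  rewrite sqr_cabs /= exprMn real_normK ?num_real//.
  have -> : (cos x - cos y) ^+ 2 + (sin x - sin y) ^+ 2 =
    (cos x ^+ 2 + sin x ^+ 2) + (cos y ^+ 2 + sin y ^+ 2) -
    2 * (cos x * cos y + sin x * sin y) by ring.
  by rewrite !cos2Dsin2 h; ring.
by move/eqP: e; rewrite eqrXn2 ?cabs_ge0 ?mulr_ge0// => /eqP.
Qed.

(** By the mean value theorem [sin t = t cos c] with [0 < c < t <= acos k], so [k <= cos c <= 1]. *)
Lemma sin_bounds k t : 0 <= k < 1 -> 0 <= t -> t <= acos k -> k * t <= sin t <= t.
Proof.
move=> /andP[k0 k1] t0 tk.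
have [->|tn0] := eqVneq t 0; first by rewrite sin0 mulr0 lexx.
have tp : 0 < t by rewrite lt_neqAle eq_sym tn0.
have dsin (x : R) : x \in `]0, t[ -> is_derive x 1 sin (cos x) by move=> _; exact: is_derive_sin.
have [|c] := MVT tp dsin.
  by apply: continuous_subspaceT => x; exact: continuous_sin.
rewrite in_itv /= => /andP[c0 ct]; rewrite sin0 !subr0 => ->.
rewrite ler_pM2r// -{2}[t]mul1r ler_pM2r// cos_le1 andbT.
have k11 : -1 <= k <= 1 by apply/andP; split; lra.
rewrite -(@acosK _ k) ?in_itv//= leNgt ltr_cos ?in_itv /=.
- by rewrite -leNgt ltW// (lt_le_trans ct).
- by rewrite acos_ge0// acos_lepi.
- by rewrite (ltW c0)/= (le_trans (ltW ct))// (le_trans tk)// acos_lepi.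
Qed.

Lemma abs_sin_le t : `|sin t| <= `|t|.
Proof.
wlog t0 : t / 0 <= t.
  move=> H; have [/H//|/ltW t0] := leP 0 t.
  by rewrite -normrN -sinN -(normrN t); apply: H; rewrite oppr_ge0.
rewrite (ger0_norm t0); have [tp|tp] := leP t (pi / 2).
  have h := @sin_bounds 0 t; rewrite acos0 lexx ltr01 mul0r in h.
  by have /andP[s0 s1] := h isT t0 tp; rewrite ger0_norm.
by rewrite (le_trans (sin_max t))// (le_trans _ (ltW tp))// pihalf_ge1.
Qed.

Lemma chord_le x y : cabs (expi x - expi y) <= `|x - y|.
Proof.
rewrite chord (le_trans (ler_wpM2l _ (abs_sin_le _)))//.
by rewrite normrM (@gtr0_norm _ 2^-1) ?invr_gt0// mulrC divfK.
Qed.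

(** Each denominator of the interpolation formula loses a factor [k] here, so [k] must be allowed
    arbitrarily close to 1; this forces short arcs. *)
Lemma chord_ge k x y : 0 <= k < 1 -> `|x - y| / 2 <= acos k ->
  k * `|x - y| <= cabs (expi x - expi y).
Proof.
move=> k01 xy; rewrite chord.
have -> : `|sin ((x - y) / 2)| = `|sin (`|x - y| / 2)|.
  by have [h|h] := ger0P (x - y); rewrite ?mulNr ?sinN ?normrN.
have /andP[h _] := @sin_bounds k (`|x - y| / 2) k01 (divr_ge0 (normr_ge0 _) (ler0n _ _)) xy.
have h1 := ler_norm (sin (`|x - y| / 2)); lra.
Qed.

(** Continuity is imposed on real and imaginary parts because [cintegral] integrates them
    separately. *)
Definition ccont (g : R -> R[i]) :=
  continuous (fun x => complex.Re (g x)) /\ continuous (fun x => complex.Im (g x)).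

Lemma ccont_cst z : ccont (fun=> z).
Proof. by split; exact: cst_continuous. Qed.

Lemma ccont_expi : ccont (@expi R).
Proof. by split; [exact: continuous_cos|exact: continuous_sin]. Qed.

Lemma ccontD f g : ccont f -> ccont g -> ccont (fun x => f x + g x).
Proof.
move=> [f1 f2] [g1 g2]; split.
- rewrite [X in continuous X](_ : _ = (fun x => complex.Re (f x) + complex.Re (g x))).
    by move=> x; apply: cvgD; [exact: f1|exact: g1].
  by apply/funext => x; case: (f x) (g x) => [a b] [c d].
- rewrite [X in continuous X](_ : _ = (fun x => complex.Im (f x) + complex.Im (g x))).
    by move=> x; apply: cvgD; [exact: f2|exact: g2].
  by apply/funext => x; case: (f x) (g x) => [a b] [c d].
Qed.

Lemma ccontM f g : ccont f -> ccont g -> ccont (fun x => f x * g x).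
Proof.
move=> [f1 f2] [g1 g2]; split.
- rewrite [X in continuous X](_ : _ = (fun x => complex.Re (f x) * complex.Re (g x)
      - complex.Im (f x) * complex.Im (g x))).
    by move=> x; apply: cvgB; apply: cvgM;
      [exact: f1|exact: g1|exact: f2|exact: g2].
  by apply/funext => x; case: (f x) (g x) => [a b] [c d].
- rewrite [X in continuous X](_ : _ = (fun x => complex.Re (f x) * complex.Im (g x)
      + complex.Im (f x) * complex.Re (g x))).
    by move=> x; apply: cvgD; apply: cvgM;
      [exact: f1|exact: g2|exact: f2|exact: g1].
  by apply/funext => x; case: (f x) (g x) => [a b] [c d].
Qed.

Lemma ccontJ f : ccont f -> ccont (fun x => conjc (f x)).
Proof.
move=> [f1 f2]; split.
- rewrite [X in continuous X](_ : _ = (fun x => complex.Re (f x))) //.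
  by apply/funext => x; case: (f x).
- rewrite [X in continuous X](_ : _ = (fun x => - complex.Im (f x))).
    by move=> x; apply: continuousN; exact: f2.
  by apply/funext => x; case: (f x).
Qed.

Lemma ccontX f n : ccont f -> ccont (fun x => f x ^+ n).
Proof.
move=> cf; elim: n => [|n IH]; first exact: ccont_cst.
rewrite [X in ccont X](_ : _ = (fun x => f x * f x ^+ n)); first exact: ccontM.
by apply/funext => x; rewrite exprS.
Qed.

Lemma ccont_horner (p : {poly R[i]}) f : ccont f -> ccont (fun x => p.[f x]).
Proof.
move=> cf; elim/poly_ind: p => [|p c IH].
  by rewrite [X in ccont X](_ : _ = (fun=> 0)); [exact: ccont_cst|
    apply/funext => x; rewrite horner0].
rewrite [X in ccont X](_ : _ = (fun x => p.[f x] * f x + c)).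
  by apply: ccontD; [exact: ccontM|exact: ccont_cst].
by apply/funext => x; rewrite hornerMXaddC.
Qed.

Lemma ccont_comp g (h : R -> R) : ccont g -> continuous h -> ccont (g \o h).
Proof.
move=> [g1 g2] ch; split => x.
- by apply: (@continuous_comp _ _ _ h (fun x => complex.Re (g x)));
    [exact: ch|exact: g1].
- by apply: (@continuous_comp _ _ _ h (fun x => complex.Im (g x)));
    [exact: ch|exact: g2].
Qed.

Lemma ccont_sqr_cabs g : ccont g -> continuous (fun x => cabs (g x) ^+ 2).
Proof.
move=> [g1 g2]; rewrite [X in continuous X](_ : _ =
    (fun x => complex.Re (g x) ^+ 2 + complex.Im (g x) ^+ 2)).
  by move=> x; apply: cvgD; apply: cvgM;
    [exact: g1|exact: g1|exact: g2|exact: g2].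
by apply/funext => x; rewrite sqr_cabs.
Qed.

End UnitCircle.

(** * A Remez inequality on small arcs *)

Section Remez.
Context {R : realType}.
Notation mu := (@lebesgue_measure R).
Implicit Types (B : set R) (l w x y s t : R).

(** [B] is the set to avoid, and this is the length of [[0, t]] outside [B]. As a function of [t] it
    is nondecreasing and 1-Lipschitz. *)
Definition good_length B t : R := t - fine (mu (B `&` `[0, t])).

Lemma good_length0 B : measurable B -> good_length B 0 = 0.
Proof.
move=> mB; rewrite /good_length sub0r; apply/eqP; rewrite oppr_eq0; apply/eqP.
suff -> : mu (B `&` `[0, 0]) = 0%E by [].
apply/eqP; rewrite eq_le measure_ge0 andbT.
have <- : mu `[(0 : R), 0] = 0%E by rewrite lebesgue_measure_itv /= ltxx.
by apply: le_measure; rewrite ?inE//; exact: measurableI.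
Qed.

Lemma good_lengthB B s t : measurable B -> 0 <= s -> s <= t ->
  good_length B t - good_length B s = (t - s) - fine (mu (B `&` `]s, t])).
Proof.
move=> mB s0 st; rewrite /good_length.
have fin (i : interval R) : `[0, t] `&` [set` i] = [set` i] -> mu (B `&` [set` i]) \is a fin_num.
  move=> it; rewrite ge0_fin_numE//; apply: (@le_lt_trans _ _ (mu `[0, t])).
    apply: le_measure; rewrite ?inE//; first exact: measurableI.
    by rewrite -it => x [_ []].
  by rewrite lebesgue_measure_itv /=; case: ifP => _; rewrite ltry.
have -> : B `&` `[0, t] = (B `&` `[0, s]) `|` (B `&` `]s, t]).
  by rewrite -setIUr -itv_bndbnd_setU// bnd_simp.
rewrite measureU//.
- rewrite fineD; first by ring.
    apply: fin; apply/setIidr => x /=; rewrite !in_itv /= => /andP[-> xs].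
    exact: le_trans xs st.
  apply: fin; apply/setIidr => x /=; rewrite !in_itv /= => /andP[sx ->].
  by rewrite andbT (le_trans s0)// ltW.
- exact: measurableI.
- exact: measurableI.
- rewrite -subset0 => x [[_ /=]]; rewrite !in_itv/= => /andP[_ xs] [_ /andP[sx _]].
  by move: sx; rewrite ltNge xs.
Qed.

Lemma good_length_bounds B s t : measurable B -> 0 <= s -> s <= t ->
  0 <= good_length B t - good_length B s <= t - s.
Proof.
move=> mB s0 st; rewrite good_lengthB//.
have h0 : (0 <= mu (B `&` `]s, t]))%E by rewrite measure_ge0.
have h1 : (mu (B `&` `]s, t]) <= (t - s)%:E)%E.
  apply: (@le_trans _ _ (mu `]s, t])).
    by apply: le_measure; rewrite ?inE//; exact: measurableI.
  rewrite lebesgue_measure_itv /= lte_fin; case: ifPn => // _.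
  by rewrite lee_fin subr_ge0.
move: h0 h1; case: (mu _) => [r| |]//=; rewrite !lee_fin => h0 h1; lra.
Qed.

Lemma good_length_dist B s t : measurable B -> 0 <= s -> 0 <= t ->
  `|good_length B s - good_length B t| <= `|s - t|.
Proof.
move=> mB; wlog st : s t / s <= t.
  move=> H s0 t0; have [st|/ltW ts] := leP s t; first exact: H.
  by rewrite distrC (distrC s); exact: H.
move=> s0 t0; have /andP[h0 h1] := good_length_bounds B s t mB s0 st.
by rewrite distrC (distrC s) !ger0_norm// subr_ge0.
Qed.

Lemma good_length_const B s t : measurable B -> 0 <= s -> s <= t -> `]s, t] `<=` B ->
  good_length B t = good_length B s.
Proof.
move=> mB s0 st sB; apply/eqP; rewrite -subr_eq0 good_lengthB//.
rewrite (setIidr sB) lebesgue_measure_itv /= lte_fin.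
case: ifPn => [_|]; first by rewrite -EFinB /= subrr.
by rewrite -leNgt => ts; have -> : s = t; [apply: le_anti; rewrite st ts|rewrite subr0 subrr].
Qed.

Lemma good_length_preimage B l y : measurable B -> 0 < y -> 0 <= l -> y < good_length B l ->
  exists t, [/\ 0 <= t, t <= l, good_length B t = y &
    forall r, 0 < r -> exists u, [/\ 0 <= u, u <= l, `|u - t| < r & ~ B u]].
Proof.
move=> mB y0 l0 yl.
pose A := [set t | 0 <= t <= l /\ y <= good_length B t].
have Al : A l by split; [rewrite l0 lexx|exact: ltW].
have lbA : has_inf A by split; [exists l|exists 0 => t [/andP[]]].
pose t := inf A.
have tl : t <= l by apply: ge_inf => //; have [] := lbA.
have t0 : 0 <= t by apply: lb_le_inf; [exists l|move=> u [/andP[]]].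
have below u : 0 <= u -> u < t -> good_length B u < y.
  move=> u0 ut; rewrite ltNge; apply/negP => yu.
  suff : t <= u by rewrite leNgt ut.
  by apply: ge_inf; [have [] := lbA|split => //; rewrite u0 (le_trans (ltW ut))].
have yt : y <= good_length B t.
  rewrite leNgt; apply/negP => ty.
  have [|u [/andP[u0 ul] yu] ut] := @inf_adherent _ A (y - good_length B t) _ lbA.
    by rewrite subr_gt0.
  have tu : t <= u by apply: ge_inf; [have [] := lbA|split => //; rewrite u0].
  have /andP[_] := good_length_bounds B t u mB t0 tu.
  rewrite -/t in ut; lra.
have ty : good_length B t <= y.
  rewrite leNgt; apply/negP => ty.
  have tp : 0 < t.
    rewrite lt_neqAle t0 andbT; apply/eqP => t00.
    by move: ty; rewrite -t00 good_length0// => /(lt_trans y0); rewrite ltxx.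
  pose u := Num.max 0 (t - (good_length B t - y) / 2).
  have u0 : 0 <= u by rewrite le_max lexx.
  have ut : u < t by rewrite gt_max tp /=; lra.
  have uu : t - (good_length B t - y) / 2 <= u by rewrite le_max lexx orbT.
  have h := below u u0 ut; have /andP[_] := good_length_bounds B u t mB u0 (ltW ut).
  lra.
have gt : good_length B t = y by apply: le_anti; rewrite ty yt.
exists t; split => // r r0; apply: contrapT => H.
have tp : 0 < t.
  rewrite lt_neqAle t0 andbT; apply/eqP => t00.
  by move: y0; rewrite -gt -t00 good_length0// ltxx.
pose u := Num.max 0 (t - r / 2).
have u0 : 0 <= u by rewrite le_max lexx.
have ut : u < t by rewrite gt_max tp /=; lra.
have uu : t - r / 2 <= u by rewrite le_max lexx orbT.
suff e : good_length B t = good_length B u by have := below u u0 ut; rewrite -e gt ltxx.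
apply: good_length_const => //; first exact: ltW.
move=> v /=; rewrite in_itv /= => /andP[uv vt]; apply: contrapT => nBv.
apply: H; exists v; split => //.
- by rewrite (le_trans u0)// ltW.
- by rewrite (le_trans vt).
- by rewrite distrC ger0_norm ?subr_ge0//; lra.
Qed.

(** The difference of the two sides, as a polynomial in [a], has size at most [N] and [N] distinct
    roots. *)
Lemma lagrange_interpolation (K : fieldType) N (z : 'I_N -> K) (p : {poly K}) (a : K) :
  injective z -> (size p <= N)%N ->
  p.[a] = \sum_(j < N) p.[z j] * \prod_(k < N | k != j) ((a - z k) / (z j - z k)).
Proof.
move=> zi sp.
pose L j : {poly K} := \prod_(k < N | k != j) ((z j - z k)^-1 *: ('X - (z k)%:P)).
have LE j b : (L j).[b] = \prod_(k < N | k != j) ((b - z k) / (z j - z k)).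
  by rewrite horner_prod; apply: eq_bigr => k _; rewrite hornerZ hornerXsubC mulrC.
pose q := p - \sum_(j < N) p.[z j] *: L j.
have qE b : q.[b] = p.[b] - \sum_(j < N) p.[z j] * \prod_(k < N | k != j) ((b - z k) / (z j - z k)).
  by rewrite hornerD hornerN horner_sum; congr (_ - _); apply: eq_bigr => j _;
    rewrite hornerZ LE.
suff q0 : q = 0 by apply/eqP; rewrite -subr_eq0 -qE q0 horner0.
have sL j : (size (L j) <= N)%N.
  rewrite /L scaler_prod (leq_trans (size_scale_leq _ _))// -big_filter.
  rewrite size_prod_XsubC deprecated_filter_index_enum -cardE.
  by rewrite [#|_|](cardC1 j) card_ord prednK// (leq_trans _ (ltn_ord j)).
apply/eqP; apply: contraT => q0.
have sq : (size q <= N)%N.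
  rewrite (leq_trans (size_polyD _ _))// size_polyN geq_max sp.
  rewrite (leq_trans (size_sum _ _ _))//; apply/bigmax_leqP => j _.
  by rewrite (leq_trans (size_scale_leq _ _)).
have := max_poly_roots q0 (rs := [seq z j | j : 'I_N]).
rewrite size_map size_enum_ord map_inj_uniq// enum_uniq ltnNge sq => H.
suff /H/(_ isT) : all (root q) [seq z j | j : 'I_N] by [].
apply/allP => _ /mapP[i _ ->].
rewrite rootE qE (bigD1 i)//= big1 ?mulr1 ?big1 ?addr0 ?subrr// => [k ki|k ki].
  by rewrite (bigD1 i) 1?eq_sym//= subrr mul0r mul0r mulr0.
by rewrite divff// subr_eq0 (inj_eq zi) eq_sym.
Qed.
End Remez.

Section RemezArc.
Context {R : realType}.
Notation mu := (@lebesgue_measure R).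
Implicit Types (B : set R).

(** Carries a bound from the good points to the interpolation nodes, which are only limits of good
    points. *)
Lemma continuous_le_closure (g : R -> R) (K l t : R) : continuous g ->
  (forall r, 0 < r -> exists u, `|u - t| < r /\ g u <= K) -> g t <= K.
Proof.
move=> cg H; rewrite leNgt; apply/negP => Kt.
have /cvgrPdist_lt H1 := cg t.
have : 0 < g t - K by rewrite subr_gt0.
move=> /H1/nbhs_ballP[r /= r0 Hr].
have [u [ur uK]] := H r r0.
have := Hr u; rewrite /ball/= distrC => /(_ ur) h.
have := ler_norm (g t - g u); lra.
Qed.

(** The node [t j] has as good length the image of the [j]-th Chebyshev node under the affine map
    from [[-1, 1]] onto [[0, w]] that sends 1 to 0. This map sends [X] to [-(l - w)], the place of
    [x0] if the whole allowed bad length came before the nodes; that determines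
    [w = 2 l / (X + 1)]. *)
Lemma remez_arc (kap X s l x0 sg K : R) B (N : nat) (P : {poly R[i]}) :
  0 < kap < 1 -> 1 < X -> 0 <= s -> s ^+ 2 = X ^+ 2 - 1 ->
  0 < l -> l / 2 <= acos kap -> `|sg| = 1 -> measurable B ->
  (mu (B `&` `[0%R, l]) <= (l - 2 * l / (X + 1))%:E)%E ->
  (0 < N)%N -> (size P <= N)%N ->
  (forall t, 0 <= t <= l -> ~ B t -> cabs P.[expi (x0 + sg * t)] <= K) ->
  cabs P.[expi x0] <= K * (kap ^- N * ((X + s) ^+ N / (X - 1))).
Proof.
move=> /andP[k0 k1] X1 s0 s2 l0 lk sg1 mB muB N0 sP PK.
have X10 : X + 1 != 0 by rewrite gt_eqF//; lra.
pose w := 2 * l / (X + 1).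
have lw : l - w = w / 2 * (X - 1) by rewrite /w; field.
have w0 : 0 < w by rewrite divr_gt0//; lra.
have wl : w <= good_length B l.
  rewrite /good_length; move: muB; rewrite -/w.
  have : (0 <= mu (B `&` `[0%R, l]))%E by rewrite measure_ge0.
  by case: (mu _) => [r| |]//=; rewrite !lee_fin; lra.
pose y (j : 'I_N) := w / 2 * (1 - cheb_node N j).
have node (j : 'I_N) : exists t, [/\ 0 <= t, t <= l, good_length B t = y j &
    forall r, 0 < r -> exists u, [/\ 0 <= u, u <= l, `|u - t| < r & ~ B u]].
  have /andP[c1 c2] := @cheb_node_le1 R N j.
  apply: good_length_preimage => //; [|exact: ltW|].
    by rewrite /y mulr_gt0//; lra.
  by apply: lt_le_trans wl; rewrite /y; nra.
pose t j := sval (cid (node j)).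
have [t0 [tl [ty tcl]]] : (forall j, 0 <= t j) /\ (forall j, t j <= l) /\
   (forall j, good_length B (t j) = y j) /\ (forall j r, 0 < r ->
    exists u, [/\ 0 <= u, u <= l, `|u - t j| < r & ~ B u]).
  by split; [|split; [|split]] => j; rewrite /t; case: (cid _) => ? [].
have y_dist j k : `|y j - y k| = w / 2 * `|cheb_node N j - cheb_node N k|.
  have -> : y j - y k = w / 2 * (cheb_node N k - cheb_node N j) by rewrite /y; ring.
  rewrite normrM (distrC (cheb_node N k)). have hw : 0 < w / 2 by rewrite divr_gt0. by rewrite (gtr0_norm hw).
have tdist j k : w / 2 * `|cheb_node N j - cheb_node N k| <= `|t j - t k|.
  by rewrite -y_dist -!ty good_length_dist.
(* The good length between [t k] and [l] is at most [l - t k], hence [t k <= y k + (l - w)]. *)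
have tup k : t k <= w / 2 * (X - cheb_node N k).
  have /andP[_ +] := good_length_bounds B (t k) l mB (t0 k) (tl k).
  rewrite ty /y => h.
  have -> : w / 2 * (X - cheb_node N k) = w / 2 * (X - 1) + w / 2 * (1 - cheb_node N k) by ring.
  rewrite -lw; lra.
pose z j := expi (x0 + sg * t j).
have zdist j k : kap * `|t j - t k| <= cabs (z j - z k).
  have e : `|x0 + sg * t j - (x0 + sg * t k)| = `|t j - t k|.
    by rewrite opprD addrACA subrr add0r -mulrBr normrM sg1 mul1r.
  rewrite -e; apply: chord_ge; first by rewrite k1 ltW.
  rewrite e (le_trans _ lk)// ler_pM2r ?invr_gt0// ler_norml.
  by have := t0 j; have := t0 k; have := tl j; have := tl k; lra.
have cheb_gt0 j k : k != j -> 0 < `|cheb_node N j - cheb_node N k : R|.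
  by move=> kj; rewrite normr_gt0 subr_eq0; apply: contra kj => /eqP/cheb_node_inj ->.
have zinj : injective z.
  move=> j k jk; apply/eqP; apply: contraT => njk.
  have := zdist j k; rewrite jk subrr /cabs Normc.normc0.
  have := tdist j k; have := cheb_gt0 j k; rewrite eq_sym njk => /(_ isT) h1 h2.
  rewrite leNgt mulr_gt0// (lt_le_trans _ h2)// mulr_gt0// divr_gt0//.
have Pz j : cabs P.[z j] <= K.
  rewrite /z; apply: (@continuous_le_closure (fun u => cabs P.[expi (x0 + sg * u)]) K l).
    have cc : ccont (fun u => P.[expi (x0 + sg * u)]).
      apply: (@ccont_comp _ (fun u => P.[expi u]) (fun u => x0 + sg * u)).
        by apply: ccont_horner; exact: ccont_expi.
      by move=> u; apply: cvgD; [exact: cvg_cst|apply: cvgM; [exact: cvg_cst|exact: cvg_id]].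
    move=> u; rewrite /continuous_at [X in X @ _ --> _](_ : _ =
      (fun u => Num.sqrt (cabs P.[expi (x0 + sg * u)] ^+ 2))); last first.
      by apply/funext => v; rewrite sqrtr_sqr ger0_norm// cabs_ge0.
    rewrite -[X in _ --> X](ger0_norm (cabs_ge0 _)) -sqrtr_sqr.
    by apply: (@continuous_comp _ _ _ (fun u => cabs P.[expi (x0 + sg * u)] ^+ 2) Num.sqrt);
      [exact: ccont_sqr_cabs|exact: sqrt_continuous].
  move=> r /(tcl j)[u [u0 ul ur nBu]]; exists u; split => //.
  by apply: PK => //; rewrite u0.
have K0 : 0 <= K by rewrite (le_trans (cabs_ge0 _) (Pz (Ordinal N0))).
rewrite (@lagrange_interpolation _ N z P _ zinj sP).
apply: (le_trans (cabs_sum _ _ _ _)).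
have step j : cabs (P.[z j] * \prod_(k < N | k != j) ((expi x0 - z k) / (z j - z k))) <=
   K * (kap ^- N * \prod_(k < N | k != j)
     ((X - cheb_node N k) / `|cheb_node N j - cheb_node N k|)).
  rewrite cabsM ler_pM ?cabs_ge0// cabs_prod.
  apply: (@le_trans _ _ (\prod_(k < N | k != j) (kap^-1 *
     ((X - cheb_node N k) / `|cheb_node N j - cheb_node N k|)))).
    apply: ler_prod => k kj; rewrite cabs_ge0 andTb cabsM cabsV.
    have c0 := cheb_gt0 j k kj; have d1 := zdist j k; have d2 := tdist j k.
    have t0' : 0 < `|t j - t k| by rewrite (lt_le_trans _ d2)// mulr_gt0// divr_gt0.
    have z0 : 0 < cabs (z j - z k) by rewrite (lt_le_trans _ d1)// mulr_gt0.
    have n1 : cabs (expi x0 - z k) <= w / 2 * (X - cheb_node N k).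
      apply: le_trans (tup k); rewrite /z -{1}[x0]addr0.
      apply: (le_trans (chord_le _ _)).
      by rewrite opprD addrACA subrr add0r sub0r normrN normrM sg1 mul1r ger0_norm.
    rewrite ler_pdivrMr//; apply: (le_trans n1).
    set c := `|cheb_node _ _ - _| in c0 d2 *; set d := X - _ in n1 *.
    have d0 : 0 <= d.
      have w20 : 0 < w / 2 by rewrite divr_gt0.
      by rewrite -(pmulr_rge0 _ w20) (le_trans (cabs_ge0 _) n1).
    apply: (@le_trans _ _ (kap^-1 * (d / c) * (kap * (w / 2 * c)))).
      have -> // : kap^-1 * (d / c) * (kap * (w / 2 * c)) = w / 2 * d.
      by field; rewrite !gt_eqF.
    apply: ler_wpM2l; first by apply: mulr_ge0; [rewrite invr_ge0 ltW|apply: divr_ge0 => //; exact: ltW].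
    by rewrite (le_trans _ d1)// ler_wpM2l// ltW.
  rewrite big_split /= ler_wpM2r//.
    apply: prodr_ge0 => k kj; rewrite divr_ge0 ?ltW ?cheb_gt0// subr_gt0.
    by have /andP[_ +] := @cheb_node_le1 R N k; move=> h; apply: lt_trans X1.
  rewrite prodr_const -exprVn ler_weXn2l// ?invf_ge1 ?ltW//.
  by rewrite (leq_trans (max_card _))// card_ord.
apply: (le_trans (ler_sum _ (fun j _ => step j))).
rewrite -mulr_sumr -mulr_sumr ler_wpM2l//.
apply: ler_wpM2l; first by rewrite invr_ge0 exprn_ge0// ltW.
exact: cheb_lagrange.
Qed.
End RemezArc.

(** * Arcs, angles and translates of measurable sets *)

Section Geometry.
Context {R : realType}.
Notation mu := (@lebesgue_measure R).

(** By uniqueness of Lebesgue measure it suffices to check half-open intervals; a reflection only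
    exchanges which end is closed. *)
Lemma lebesgue_affine (c sg : R) (A : set R) : `|sg| = 1 -> measurable A ->
  mu [set t | A (c + sg * t)] = mu A.
Proof.
move=> sg1 mA; pose h (t : R) : R := c + sg * t.
have mh : measurable_fun [set: measurableTypeR R] (h : measurableTypeR R -> measurableTypeR R).
  apply: continuous_measurable_fun => t.
  by apply: cvgD; [exact: cvg_cst|apply: cvgM; [exact: cvg_cst|exact: cvg_id]].
suff : pushforward mu (h : _ -> measurableTypeR R) A = mu A by [].
apply/esym/lebesgue_measure_unique => //= _ [[a b] _ <-].
rewrite /pushforward lebesgue_measure_itv /=.
have [sg_1|sg_1] : sg = 1 \/ sg = -1.
  have [h0|h0] := ger0P sg; first by left; rewrite -sg1 ger0_norm.
  by right; rewrite -sg1 ltr0_norm// opprK.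
- have -> : h @^-1` `]a, b] = `]a - c, b - c]%classic.
    by apply/seteqP; split => t /=; rewrite !in_itv /= /h sg_1 mul1r => /andP[h1 h2];
      apply/andP; split; lra.
  rewrite lebesgue_measure_itv /= !lte_fin ltrD2r.
  by case: ifP => // _; rewrite -!EFinD; congr EFin; ring.
- have -> : h @^-1` `]a, b] = `[c - b, c - a[%classic.
    by apply/seteqP; split => t /=; rewrite !in_itv /= /h sg_1 mulN1r => /andP[h1 h2];
      apply/andP; split; lra.
  rewrite lebesgue_measure_itv /= !lte_fin ltrD2l ltrN2.
  by case: ifP => // _; rewrite -!EFinD; congr EFin; ring.
Qed.

Lemma expi_principal (t : R) : exists2 x : R, Lam x & expi x = expi t.
Proof.
have c1 : -1 <= cos t <= 1 by rewrite cos_geN1 cos_le1.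
have a0 := acos_ge0 c1; have a1 := acos_lepi c1.
have s2 : Num.sqrt (1 - cos t ^+ 2) = `|sin t| by rewrite -sin2cos2 sqrtr_sqr.
have [h|h] := ger0P (sin t).
- exists (acos (cos t)); first by rewrite /Lam /= in_itv /= a1 andbT; lra.
  by rewrite /expi sin_acos// acosK ?in_itv// s2 ger0_norm.
- exists (- acos (cos t)); first by rewrite /Lam /= in_itv /=; lra.
  by rewrite /expi cosN sinN sin_acos// acosK ?in_itv// s2 ltr0_norm// opprK.
Qed.

(** Take [l] at most half the length of every arc: from any point of an arc, one of the two
    directions then stays in it for length [l]. *)
Lemma arcs_inner_segments (F : set R[i]) : finite_union_closed_arcs F ->
  exists2 l : R, 0 < l & forall z, F z -> exists x sg, [/\ Lam x, `|sg| = 1,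
    expi x = z & forall t, 0 <= t <= l -> F (expi (x + sg * t))].
Proof.
move=> [s [Hs ->]].
have [l l0 Hl] : exists2 l : R, 0 < l & forall ab, ab \in s -> l <= (ab.2 - ab.1) / 2.
  elim: s Hs => [|ab s IH] Hs; first by exists 1.
  have [|l l0 Hl] := IH; first by move=> cd cds; apply: Hs; rewrite inE cds orbT.
  have /andP[h _] := Hs ab (mem_head _ _).
  exists (Num.min l ((ab.2 - ab.1) / 2)).
    by rewrite lt_min l0 divr_gt0// subr_gt0.
  move=> cd; rewrite inE => /predU1P[->|/Hl h']; first by rewrite ge_min lexx orbT.
  by rewrite ge_min h'.
exists l => // z [ab /= abs [u]]; rewrite /= in_itv /= => /andP[au ub] <-.
have [x Lx ex] := expi_principal u.
have hl := Hl _ abs.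
have inF v : ab.1 <= v <= ab.2 ->
    (\bigcup_(ab0 in [set ab0 | ab0 \in s]) closed_arc ab0.1 ab0.2) (expi v).
  by move=> hv; exists ab => //; exists v; rewrite //= in_itv.
have [hu|hu] := leP (u + l) ab.2.
- exists x, 1; split => //; rewrite ?normr1// => t /andP[t0 tl].
  by rewrite expiD ex -expiD; apply: inF; apply/andP; split; lra.
- exists x, (-1); split => //; rewrite ?normrN1// => t /andP[t0 tl].
  by rewrite expiD ex -expiD; apply: inF; apply/andP; split; lra.
Qed.

Lemma closed_clEf_angles (f : R -> R) : closed [set x | clEf f (expi x)].
Proof.
move=> x clx e e0.
have [y [/= Fy xy]] := clx _ (nbhsx_ballx x (e / 2) (divr_gt0 e0 (ltr0n _ 2))).
have [w Ew yw] := Fy (e / 2) (divr_gt0 e0 (ltr0n _ 2)).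
exists w => //; have -> : expi x - w = (expi x - expi y) + (expi y - w).
  by rewrite addrA subrK.
apply: (le_lt_trans (cabsD _ _)); rewrite [e]splitr.
by apply: ltrD => //; apply: le_lt_trans xy; exact: chord_le.
Qed.

(* [Lam] represents the circle only modulo [2 * pi], so [B] is pulled back through three translates. *)
Definition unroll (B : set R) (x sg : R) : set R :=
  [set t | B (x + sg * t)] `|` ([set t | B (x + pi *+ 2 + sg * t)] `|`
  [set t | B (x - pi *+ 2 + sg * t)]).

Lemma measurable_affine (c sg : R) (A : set R) : measurable A ->
  measurable [set t : R | A (c + sg * t)].
Proof.
move=> mA; rewrite -[X in measurable X]setTI.
have mh : measurable_fun [set: R] (fun t : R => c + sg * t).
  apply: continuous_measurable_fun => t.
  by apply: cvgD; [exact: cvg_cst|apply: cvgM; [exact: cvg_cst|exact: cvg_id]].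
exact: mh.
Qed.

Lemma measurable_unroll (B : set R) x sg : measurable B -> measurable (unroll B x sg).
Proof.
move=> mB; apply: measurableU; first exact: measurable_affine.
by apply: measurableU; exact: measurable_affine.
Qed.

Lemma mu_unroll (B : set R) x sg (d : R) : measurable B -> `|sg| = 1 -> (mu B <= d%:E)%E ->
  (mu (unroll B x sg) <= (3 * d)%:E)%E.
Proof.
move=> mB sg1 Bd.
pose S (c : R) : set R := [set t | B (c + sg * t)].
have mS c : measurable (S c) by exact: measurable_affine.
have muS c : (mu (S c) <= d%:E)%E by rewrite /S lebesgue_affine.
have -> : 3 * d = d + (d + d) by ring.
rewrite -[unroll _ _ _]/(S x `|` (S (x + pi *+ 2) `|` S (x - pi *+ 2))).
have mU := measurableU _ _ (mS (x + pi *+ 2)) (mS (x - pi *+ 2)).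
have h1 := measureU2 mu (mS x) mU.
have h2 := measureU2 mu (mS (x + pi *+ 2)) (mS (x - pi *+ 2)).
apply: (le_trans h1); rewrite EFinD; apply: leeD; first exact: muS.
by apply: (le_trans h2); rewrite EFinD; apply: leeD; exact: muS.
Qed.

(** As [t <= pi], the angle [x + sg * t] leaves [Lam] by at most [pi], so a shift by [2 pi] one way
    or the other brings it back. *)
Lemma unrollP (B : set R) x sg t : Lam x -> `|sg| = 1 -> 0 <= t <= pi -> ~ unroll B x sg t ->
  exists y, [/\ Lam y, ~ B y & expi y = expi (x + sg * t)].
Proof.
rewrite /Lam /= in_itv /= => /andP[x0 x1] sg1 /andP[t0 t1] nU.
have : `|sg * t| <= pi by rewrite normrM sg1 mul1r ger0_norm.
rewrite ler_norml => /andP[st0 st1].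
have p0 := pi_gt0 R.
have [h|h] := leP (x + sg * t) (- pi).
  exists (x + pi *+ 2 + sg * t); split.
  - by rewrite in_itv /=; apply/andP; split; lra.
  - by move=> By; apply: nU; right; left.
  - by rewrite addrAC expiD2pi.
have [h'|h'] := leP (x + sg * t) pi.
  exists (x + sg * t); split => //.
  - by rewrite in_itv /= h' ltW.
  - by move=> By; apply: nU; left.
exists (x - pi *+ 2 + sg * t); split.
- by rewrite in_itv /=; apply/andP; split; lra.
- by move=> By; apply: nU; right; right.
- by rewrite -expiD2pi; congr expi; ring.
Qed.

End Geometry.

(** * The weighted Remez inequality *)

Section WeightedRemez.
Context {R : realType}.
Notation mu := (@lebesgue_measure R).

Lemma measurable_Lam : measurable (@Lam R).
Proof. exact: measurable_itv. Qed.
#[local] Hint Resolve measurable_Lam : core.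

Lemma mu_Lam : (mu (@Lam R) < +oo)%E.
Proof. by rewrite /Lam lebesgue_measure_itv /=; case: ifP => _; rewrite ?ltry. Qed.

Lemma weight_measurable (f : R -> R) : spectral_density f ->
  measurable_fun (@Lam R) f.
Proof.
by move=> [_ [fi _]]; apply/measurable_EFinP; exact: measurable_int fi.
Qed.

Lemma markov_Lam (g : R -> R) (a : R) : 0 < a -> mu.-integrable (@Lam R) (EFin \o g) ->
  (forall x, Lam x -> 0 <= g x) ->
  (mu (@Lam R `&` [set x | (a <= g x)%R]) <= (Rintegral mu (@Lam R) g / a)%:E)%E.
Proof.
move=> a0 gi g0; have mg := measurable_int _ gi.
have := @le_integral_comp_abse _ _ _ mu (@Lam R) measurable_Lam (EFin \o g) a id
  (@measurable_id _ _ _) (fun r h => h) (fun x y _ _ h => h) mg a0.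
have -> : @Lam R `&` [set x | (a%:E <= `|(EFin \o g) x|)%E] = @Lam R `&` [set x | a <= g x].
  by apply/seteqP; split => x /= [Lx h]; split => //; move: h;
    rewrite lee_fin ger0_norm// g0.
have -> : (\int[mu]_(x in @Lam R) `|(EFin \o g) x| = (Rintegral mu (@Lam R) g)%:E)%E.
  rewrite /Rintegral fineK; last exact: integrable_fin_num.
  by apply: eq_integral => x; rewrite inE => Lx /=; rewrite ger0_norm// g0.
by move=> h; rewrite EFinM lee_pdivlMr// muleC.
Qed.

(** For [eta = 1 / (n + 1)] the sets decrease inside [Lam], which has finite measure, and their
    intersection is null because [f > 0] almost everywhere there. Continuity from above
    concludes. *)
Lemma small_weight (f : R -> R) (d : R) : spectral_density f ->
  {ae mu, forall x, Lam x -> clEf f (expi x) -> 0 < f x} -> 0 < d ->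
  exists2 eta : R, 0 < eta &
    let B := [set x | clEf f (expi x)] `&` (@Lam R `&` [set x | f x < eta]) in
    measurable B /\ (mu B <= d%:E)%E.
Proof.
move=> sf [N [mN N0 HN]] d0; have mf := weight_measurable f sf.
have mcl : measurable [set x | clEf f (expi x)].
  by apply: (@closed_measurable R); exact: closed_clEf_angles.
pose B (n : nat) := [set x | clEf f (expi x)] `&` (@Lam R `&` [set x | f x < n.+1%:R^-1]).
have mB n : measurable (B n).
  apply: measurableI => //; rewrite -[X in measurable X]/(@Lam R `&` f @^-1` [set y | y < n.+1%:R^-1]).
  apply: mf => //; rewrite (_ : [set _ | _] = `]-oo, n.+1%:R^-1[%classic); first exact: measurable_itv.
  by apply/seteqP; split => y /=; rewrite in_itv.
have mcap : measurable (\bigcap_n B n) by apply: bigcapT_measurable.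
have cap0 : mu (\bigcap_n B n) = 0%E.
  apply/eqP; rewrite eq_le measure_ge0 andbT -N0; apply: le_measure; rewrite ?inE//.
  move=> x Bx; apply: HN => /= H.
  have [clx [Lx _]] := Bx 0%N I.
  have [n _ /(_ n (leqnn n)) /= nf] := near_infty_natSinv_lt (PosNum (H Lx clx)).
  by have [_ [_ /=]] := Bx n I => h; have := lt_trans h nf; rewrite ltxx.
have : mu \o B @ \oo --> mu (\bigcap_n B n).
  apply: nonincreasing_cvg_mu => //.
    apply: le_lt_trans mu_Lam; apply: le_measure; rewrite ?inE//.
    exact: mB.
    by move=> x [_ []].
  move=> n m nm; apply/subsetPset => x [clx [Lx /= fx]]; split => //; split => //=.
  by apply: (lt_le_trans fx); rewrite lef_pV2 ?posrE// ler_nat.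
rewrite cap0 => cvgB.
have : \forall n \near \oo, (mu (B n) < d%:E)%E.
  have nb : nbhs (0%E : \bar R) [set y | (y < d%:E)%E].
    by apply: open_nbhs_nbhs; split; [exact: open_ereal_lt_ereal|rewrite /= lte_fin].
  exact: (cvgB _ nb).
case=> n _ /(_ n (leqnn n)) /= h; exists n.+1%:R^-1; first by rewrite invr_gt0.
by split; [exact: mB|exact: ltW].
Qed.

Lemma remez_constants (c : R) : 1 < c -> exists k X s : R,
  [/\ 0 < k < 1, 1 < X, 0 <= s, s ^+ 2 = X ^+ 2 - 1 & (k^-1 * (X + s)) ^+ 2 = c].
Proof.
move=> c1; pose q := Num.sqrt (Num.sqrt c).
have q4 : (q ^+ 2) ^+ 2 = c by rewrite sqr_sqrtr ?sqrtr_ge0// sqr_sqrtr//; lra.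
have q0 : 0 <= q by rewrite sqrtr_ge0.
have sqrt_gt1 (u : R) : 1 < u -> 1 < Num.sqrt u.
  by move=> u1; have := @ltr_sqrt R 1 u (lt_trans ltr01 u1); rewrite sqrtr1 => ->.
have q1 : 1 < q := sqrt_gt1 _ (sqrt_gt1 _ c1).
have qn : q != 0 by rewrite gt_eqF//; lra.
have qi : q * q^-1 = 1 by rewrite divff.
have qi1 : 0 < q^-1 < 1 by rewrite invr_gt0 invf_lt1; lra.
have /andP[qi0 qi2] := qi1.
(* With [q^4 = c], the values [X] and [s] are the hyperbolic cosine and sine of [ln q], so
   [X + s = q]. The chord factor [k^-1] is also [q], and the square is there because [|P|^2] is
   estimated. *)
exists q^-1, ((q + q^-1) / 2), ((q - q^-1) / 2); split => //.
- by nra.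
- by lra.
- by field.
- by rewrite invrK -q4; congr (_ ^+ 2); field.
Qed.

Definition wnorm2 (f : R -> R) (P : {poly R[i]}) : R :=
  Rintegral mu (@Lam R) (fun x => cabs P.[expi x] ^+ 2 * f x).

Lemma wnorm2_integrable (f : R -> R) (P : {poly R[i]}) : spectral_density f ->
  mu.-integrable (@Lam R) (EFin \o (fun x => cabs P.[expi x] ^+ 2 * f x)).
Proof.
move=> [_ [fi _]].
have cg : continuous (fun x => cabs P.[expi x] ^+ 2).
  by apply: ccont_sqr_cabs; apply: ccont_horner; exact: ccont_expi.
apply: (@integrableMr _ _ _ mu _ _ (fun x => cabs P.[expi x] ^+ 2) (EFin \o f)) => //.
  by apply: measurable_funTS; exact: continuous_measurable_fun.
have [M [_ HM]] := compact_bounded (continuous_compact (continuous_subspaceT cg)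
  (@segment_compact R (- pi) pi)).
exists M; split; rewrite ?num_real// => M' MM' x Lx.
by apply: (HM M' MM'); exists x.
Qed.

(** There are two bad sets: [f < eta], fixed before [P], and [|P|^2 f >= I / d], which depends on
    [P] but has measure at most [d] by Markov's inequality. Off both, [|P|^2 <= I / (d eta)], so the
    constant depends neither on [N] nor on [P]. *)
Lemma weak_remez (f : R -> R) (c : R) : spectral_density f ->
  finite_union_closed_arcs (clEf f) ->
  {ae mu, forall x, Lam x -> clEf f (expi x) -> 0 < f x} -> 1 < c ->
  exists2 C : R, 0 < C & forall (N : nat) (P : {poly R[i]}) z,
    (0 < N)%N -> (size P <= N)%N -> 0 < wnorm2 f P -> clEf f z ->
    cabs P.[z] ^+ 2 <= C * c ^+ N * wnorm2 f P.
Proof.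
move=> sf arcs aef c1.
have [k [X [s [/[dup] k01 /andP[k0 k1] X1 s0 s2 kXs]]]] := remez_constants c c1.
have [l0 l00 Hl0] := arcs_inner_segments _ arcs.
have ak0 : 0 < acos k by apply: acos_gt0; rewrite k1 andbT; lra.
(* [l0] keeps the segment in [F], [2 * acos k] makes chords comparable with angles, and [pi] makes
   three translates enough. *)
pose l := Num.min l0 (Num.min (2 * acos k) pi).
have l_gt0 : 0 < l by rewrite !lt_min l00 pi_gt0 mulr_gt0.
have ll0 : l <= l0 by rewrite ge_min lexx.
have lk : l <= 2 * acos k by rewrite !ge_min lexx orbT.
have lpi : l <= pi by rewrite !ge_min lexx !orbT.
pose g := l - 2 * l / (X + 1).
have g0 : 0 < g.
  rewrite subr_gt0 ltr_pdivrMr; [|lra]; nra.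
(* Two bad sets of measure at most [d], each pulled back through three translates, have total length
   at most [6 d = g], the bad length that [remez_arc] allows. *)
pose d := g / 6.
have d0 : 0 < d by rewrite divr_gt0.
have [eta eta0 [mB0 muB0]] := small_weight f d sf aef d0.
set B0 := (X in measurable X) in mB0 muB0.
exists ((d * eta * (X - 1) ^+ 2)^-1).
  by rewrite invr_gt0 !mulr_gt0 ?exprn_gt0// subr_gt0.
move=> N P z N0 sP; set I := wnorm2 f P => I0 Fz.
pose h x := cabs P.[expi x] ^+ 2 * f x.
have hi : mu.-integrable (@Lam R) (EFin \o h) by exact: wnorm2_integrable.
have h0 x : Lam x -> 0 <= h x by move=> Lx; rewrite mulr_ge0 ?sqr_ge0// sf.1.
pose B1 := @Lam R `&` [set x | I / d <= h x].
have muB1 : (mu B1 <= d%:E)%E.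
  have := @markov_Lam h (I / d) (divr_gt0 I0 d0) hi h0.
  have -> // : Rintegral mu (@Lam R) h / (I / d) = d.
  by have -> : Rintegral mu (@Lam R) h = I by []; field; rewrite !gt_eqF.
have mB1 : measurable B1.
  have /measurable_EFinP mh := measurable_int _ hi.
  rewrite -[X in measurable X]/(@Lam R `&` h @^-1` [set y | I / d <= y]).
  apply: mh => //; rewrite (_ : [set _ | _] = `[I / d, +oo[%classic); first exact: measurable_itv.
  by apply/seteqP; split => y /=; rewrite in_itv /= andbT.
have mB : measurable (B0 `|` B1) by exact: measurableU.
have muB : (mu (B0 `|` B1) <= (2 * d)%:E)%E.
  have hU := measureU2 mu mB0 mB1; apply: (le_trans hU).
  have -> : 2 * d = d + d by ring.
  by rewrite EFinD; apply: leeD.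
have [x [sg [Lx sg1 ez inF]]] := Hl0 z Fz.
pose B := unroll (B0 `|` B1) x sg.
pose K := Num.sqrt (I / (d * eta)).
have de0 : 0 < d * eta by rewrite mulr_gt0.
have K2 : K ^+ 2 = I / (d * eta) by rewrite sqr_sqrtr// divr_ge0 ?ltW.
have good t : 0 <= t <= l -> ~ B t -> cabs P.[expi (x + sg * t)] <= K.
  move=> /andP[t0 tl] nB.
  have [|y [Ly nBy ey]] := unrollP _ x sg t Lx sg1 _ nB; first by rewrite t0 (le_trans tl).
  have fy : eta <= f y.
    rewrite leNgt; apply/negP => fy; apply: nBy; left; split => /=.
      by rewrite ey; apply: inF; rewrite t0 (le_trans tl).
    by split.
  have hy : h y < I / d.
    by rewrite ltNge; apply/negP => hy; apply: nBy; right; split.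
  rewrite -ey -(@ler_pXn2r _ 2) ?nnegrE ?cabs_ge0 ?sqrtr_ge0// K2.
  rewrite ler_pdivlMr//; rewrite ltr_pdivlMr// in hy.
  apply: le_trans (ltW hy).
  rewrite mulrA mulrAC; apply: ler_wpM2r; first exact: ltW.
  by rewrite /h ler_wpM2l ?sqr_ge0.
have main : cabs P.[expi x] <= K * (k ^- N * ((X + s) ^+ N / (X - 1))).
  apply: (@remez_arc _ k X s l x sg K B N P k01 X1 s0 s2 l_gt0 _ sg1) => //.
  - by rewrite ler_pdivrMr// mulrC.
  - exact: measurable_unroll.
  - rewrite -/g; have -> : g = 3 * (2 * d) by rewrite /d; field.
    apply: le_trans (mu_unroll _ x sg _ mB sg1 muB).
    have mU := measurable_unroll _ x sg mB.
    by apply: le_measure; rewrite ?inE//; apply: measurableI.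
have X10 : 0 < X - 1 by rewrite subr_gt0.
rewrite -ez; apply: (@le_trans _ _ ((K * (k ^- N * ((X + s) ^+ N / (X - 1)))) ^+ 2)).
  by rewrite ler_pXn2r ?nnegrE ?cabs_ge0// (le_trans (cabs_ge0 _) main).
have -> : k ^- N * ((X + s) ^+ N / (X - 1)) = (k^-1 * (X + s)) ^+ N / (X - 1).
  by rewrite exprMn exprVn mulrA.
rewrite exprMn K2 expr_div_n -exprM mulnC exprM kXs.
rewrite le_eqVlt; apply/orP; left; apply/eqP; field.
by rewrite !gt_eqF.
Qed.

End WeightedRemez.

(** * Orthogonal polynomials on the unit circle *)

Section Szego.
Context {R : realType}.
Notation mu := (@lebesgue_measure R).
Implicit Types (p q r : {poly R[i]}) (g h : R -> R[i]).

(** In [Lam] an angle is, up to sign, the [acos] of the real part of its point, so each of the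
    finitely many roots accounts for at most two angles. *)
Lemma angle_roots_finite p : p != 0 -> finite_set [set x | @Lam R x /\ p.[expi x] = 0].
Proof.
move=> p0; have [rs prs] := closed_field_poly_normal p.
have inrs z : p.[z] = 0 -> z \in rs.
  move/eqP; rewrite prs hornerZ mulf_eq0 lead_coef_eq0 (negbTE p0) /=.
  by rewrite -[_ == 0]/(root _ _) root_prod_XsubC.
pose A := (fun z : R[i] => acos (complex.Re z)) @` [set` rs].
pose B := (fun z : R[i] => - acos (complex.Re z)) @` [set` rs].
apply: (@sub_finite_set _ _ (A `|` B)); last first.
  by rewrite finite_setU; split; apply: finite_image; exact: finite_seq.
move=> x []; rewrite /Lam /= in_itv /= => /andP[x1 x2] /inrs xrs.
have [x0|x0] := leP 0 x.
- by left; exists (expi x) => //=; rewrite cosK// in_itv /= x0.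
- by right; exists (expi x) => //=; rewrite cosKN ?opprK// x1 ltW.
Qed.

Variables (f : R -> R) (sf : spectral_density f).

Lemma wnorm2_ge0 p : 0 <= wnorm2 f p.
Proof.
apply: Rintegral_ge0 => x Lx; rewrite mulr_ge0 ?sqr_ge0//; exact: sf.1.
Qed.

(** If the norm vanished, [f] would vanish almost everywhere off the finite zero set of [p],
    although it is positive on a set of positive measure. *)
Lemma wnorm2_gt0 p : p != 0 -> 0 < wnorm2 f p.
Proof.
move=> p0; rewrite lt_neqAle wnorm2_ge0 andbT; apply/eqP => W0.
have [f0 [fi fpos]] := sf.
pose h x := cabs p.[expi x] ^+ 2 * f x.
have hi : mu.-integrable (@Lam R) (EFin \o h) := wnorm2_integrable f p sf.
have h0 x : Lam x -> 0 <= h x by move=> Lx; rewrite mulr_ge0 ?sqr_ge0// f0.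
have : (\int[mu]_(x in @Lam R) `|(EFin \o h) x| = 0)%E.
  transitivity ((Rintegral mu (@Lam R) h)%:E); last by rewrite -[Rintegral _ _ _]/(wnorm2 f p) -W0.
  rewrite /Rintegral fineK; last by apply: integrable_fin_num => //; exact: measurable_Lam.
  by apply: eq_integral => x; rewrite inE => Lx /=; rewrite ger0_norm// h0.
move/(ae_eq_integral_abs mu (@measurable_Lam R) (measurable_int _ hi)).
move=> [N [mN N0 HN]].
pose S := [set x | @Lam R x /\ p.[expi x] = 0].
have S0 : mu S = 0%E.
  by apply: countable_lebesgue_measure0; apply: finite_set_countable; exact: angle_roots_finite.
have mS : measurable S.
  have -> : S = @Lam R `&` (fun x => cabs p.[expi x] ^+ 2) @^-1` [set 0].
    apply/seteqP; split => x [Lx /= px]; split => //=.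
      by rewrite px /cabs Normc.normc0 expr0n.
    by apply/eqP; rewrite -cabs_eq0 -sqrf_eq0; apply/eqP.
  have cg : continuous (fun x => cabs p.[expi x] ^+ 2).
    by apply: ccont_sqr_cabs; apply: ccont_horner; exact: ccont_expi.
  have mg : measurable_fun (@Lam R) (fun x => cabs p.[expi x] ^+ 2).
    by apply: measurable_funTS; exact: continuous_measurable_fun.
  by apply: mg; [exact: measurable_Lam|exact: measurable_set1].
have mA : measurable [set x | Lam x /\ 0 < f x].
  have mf := weight_measurable f sf.
  rewrite -[X in measurable X]/(@Lam R `&` f @^-1` [set y | 0 < y]).
  apply: mf; first exact: measurable_Lam.
  rewrite (_ : [set _ | _] = `]0, +oo[%classic); first exact: measurable_itv.
  by apply/seteqP; split => y /=; rewrite in_itv /= andbT.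
have : (mu [set x | Lam x /\ (0 < f x)%R] <= mu (N `|` S))%E.
  apply: le_measure; rewrite ?inE//; first exact: measurableU.
  move=> x /= [Lx fx]; have [px|px] := eqVneq p.[expi x] 0; first by right.
  left; apply: HN => /= H; have := H Lx => -[] /eqP.
  by rewrite mulf_eq0 sqrf_eq0 cabs_eq0 (negbTE px) /= gt_eqF.
have hU : (mu (N `|` S) <= mu N + mu S)%E by exact: (measureU2 mu mN mS).
rewrite N0 S0 adde0 in hU.
by move=> /(le_trans)/(_ hU)/(lt_le_trans fpos); rewrite ltxx.
Qed.

Definition wint g : R[i] := cintegral (fun x => g x * (f x)%:C%C).

Lemma weighted_integrable (u : R -> R) : continuous u ->
  mu.-integrable (@Lam R) (EFin \o (fun x => u x * f x)).
Proof.
move=> cu; have [_ [fi _]] := sf.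
apply: (@integrableMr _ _ _ mu _ _ u (EFin \o f)) => //; first exact: measurable_Lam.
  by apply: measurable_funTS; exact: continuous_measurable_fun.
have [M [_ HM]] := compact_bounded (continuous_compact (continuous_subspaceT cu)
  (@segment_compact R (- pi) pi)).
exists M; split; rewrite ?num_real// => M' MM' x Lx.
by apply: (HM M' MM'); exists x.
Qed.

Definition rint (u : R -> R) : R := Rintegral mu (@Lam R) (fun x => u x * f x).

Lemma wintE g : wint g =
  (rint (fun x => complex.Re (g x)) +i* rint (fun x => complex.Im (g x)))%C.
Proof.
rewrite /wint /cintegral; congr Complex; apply: eq_Rintegral => x _;
  by case: (g x) => a b /=; rewrite mulr0 ?subr0 ?add0r.
Qed.

Lemma rintD (u v : R -> R) : continuous u -> continuous v ->
  rint (fun x => u x + v x) = rint u + rint v.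
Proof.
move=> cu cv; rewrite /rint -RintegralD//; last 3 first.
- exact: measurable_Lam.
- exact: weighted_integrable.
- exact: weighted_integrable.
by apply: eq_Rintegral => x _; rewrite mulrDl.
Qed.

Lemma rintZ (a : R) (u : R -> R) : continuous u -> rint (fun x => a * u x) = a * rint u.
Proof.
move=> cu; rewrite /rint -RintegralZl//; last 2 first.
- exact: measurable_Lam.
- exact: weighted_integrable.
by apply: eq_Rintegral => x _; rewrite mulrA.
Qed.

Lemma eq_wint g h : g =1 h -> wint g = wint h.
Proof. by move=> gh; congr wint; exact/funext. Qed.

Lemma wintD g h : ccont g -> ccont h -> wint (fun x => g x + h x) = wint g + wint h.
Proof.
move=> [g1 g2] [h1 h2]; rewrite !wintE.
transitivity ((rint (fun x => complex.Re (g x) + complex.Re (h x)) +i*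
  rint (fun x => complex.Im (g x) + complex.Im (h x)))%C).
  by congr Complex; congr rint; apply/funext => x; case: (g x) (h x) => [a b] [c d].
by rewrite !rintD.
Qed.

Lemma wintZ (a : R[i]) g : ccont g -> wint (fun x => a * g x) = a * wint g.
Proof.
move=> [g1 g2]; rewrite !wintE; case: a => a b.
have cZ (k : R) (u : R -> R) : continuous u -> continuous (fun x => k * u x).
  by move=> cu x; apply: cvgM; [exact: cvg_cst|exact: cu].
transitivity ((rint (fun x => a * complex.Re (g x) + (- b) * complex.Im (g x)) +i*
  rint (fun x => a * complex.Im (g x) + b * complex.Re (g x)))%C).
  congr Complex; congr rint; apply/funext => x; case: (g x) => c d //=.
  by rewrite mulNr.
rewrite !rintD ?rintZ//; try exact: cZ.
by simpc; congr Complex; rewrite mulNr.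
Qed.

Lemma wintJ g : ccont g -> wint (fun x => conjc (g x)) = conjc (wint g).
Proof.
move=> [g1 g2]; rewrite !wintE /=.
transitivity ((rint (fun x => complex.Re (g x)) +i*
  rint (fun x => (-1) * complex.Im (g x)))%C).
  by congr Complex; congr rint; apply/funext => x; case: (g x) => c d //=; rewrite mulN1r.
by rewrite rintZ// mulN1r.
Qed.

Lemma ccont_sum n (F : 'I_n -> R -> R[i]) : (forall i, ccont (F i)) ->
  ccont (fun x => \sum_(i < n) F i x).
Proof.
elim: n F => [|n IH] F cF.
  by rewrite (_ : (fun x => _) = (fun=> 0)); [exact: ccont_cst|
    apply/funext => x; rewrite big_ord0].
rewrite (_ : (fun x => _) = (fun x => F ord0 x + \sum_(i < n) F (lift ord0 i) x)); last first.
  by apply/funext => x; rewrite big_ord_recl.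
by apply: ccontD => //; apply: (IH (fun i => F (lift ord0 i))).
Qed.

Lemma wint_sum n (F : 'I_n -> R -> R[i]) : (forall i, ccont (F i)) ->
  wint (fun x => \sum_(i < n) F i x) = \sum_(i < n) wint (F i).
Proof.
elim: n F => [|n IH] F cF.
  rewrite big_ord0; transitivity (wint (fun x => 0 * 0)).
    by apply: eq_wint => x; rewrite big_ord0 mulr0.
  by rewrite (wintZ 0 (fun=> 0)) ?mul0r//; exact: ccont_cst.
rewrite big_ord_recl -IH => [|i]; last exact: cF.
rewrite -wintD; [|exact: cF|by apply: ccont_sum => i; exact: cF].
by apply: eq_wint => x; rewrite big_ord_recl.
Qed.

Lemma ccont_poly p : ccont (fun x : R => p.[expi x]).
Proof. by apply: ccont_horner; exact: ccont_expi. Qed.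

Lemma ccont_expX k : ccont (fun x : R => expi x ^+ k).
Proof. by apply: ccontX; exact: ccont_expi. Qed.

Lemma wint_conj_poly g r n : ccont g -> (size r <= n)%N ->
  wint (fun x => g x * conjc r.[expi x]) =
  \sum_(i < n) conjc r`_i * wint (fun x => g x * conjc (expi x ^+ i)).
Proof.
move=> cg rn.
have cgi (i : nat) : ccont (fun x => g x * conjc (expi x ^+ i)).
  by apply: ccontM => //; apply: ccontJ; exact: ccont_expX.
transitivity (wint (fun x => \sum_(i < n) conjc r`_i * (g x * conjc (expi x ^+ i)))).
  apply: eq_wint => x; rewrite (horner_coef_wide _ rn) rmorph_sum mulr_sumr.
  by apply: eq_bigr => i _; rewrite rmorphM /= mulrCA.
rewrite wint_sum => [|i]; last by apply: ccontM => //; exact: ccont_cst.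
by apply: eq_bigr => i _; rewrite wintZ.
Qed.

Lemma wnorm2E p : wint (fun x => p.[expi x] * conjc p.[expi x]) = (wnorm2 f p)%:C%C.
Proof.
rewrite wintE /wnorm2 /rint; congr Complex.
  by apply: eq_Rintegral => x _; rewrite mulcJ.
transitivity (rint (fun=> 0 * 0)).
  by apply: eq_Rintegral => x _; rewrite mulcJ /= mulr0.
by rewrite rintZ ?mul0r//; exact: cst_continuous.
Qed.

Lemma wnorm2_eq p q : (forall x, cabs p.[expi x] = cabs q.[expi x]) -> wnorm2 f p = wnorm2 f q.
Proof. by move=> pq; apply: eq_Rintegral => x _; rewrite pq. Qed.

(* [szego n] is the pair of the monic orthogonal polynomial of degree [n] and its reversal [z^n conj (p (1 / conj z))]. *)
Fixpoint szego n : {poly R[i]} * {poly R[i]} :=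
  if n is m.+1 then
    let: (p, q) := szego m in
    let c := - wint (fun x => expi x * p.[expi x]) / (wnorm2 f p)%:C%C in
    ('X * p + c *: q, q + conjc c *: ('X * p))
  else (1, 1).

Definition opuc n := (szego n).1.
Definition opucR n := (szego n).2.
Definition szego_coef n :=
  - wint (fun x => expi x * (opuc n).[expi x]) / (wnorm2 f (opuc n))%:C%C.

Lemma opucS n : opuc n.+1 = 'X * opuc n + szego_coef n *: opucR n.
Proof. by rewrite /szego_coef /opuc /opucR /=; case: (szego n). Qed.

Lemma opucRS n : opucR n.+1 = opucR n + conjc (szego_coef n) *: ('X * opuc n).
Proof. by rewrite /szego_coef /opuc /opucR /=; case: (szego n). Qed.

Lemma size_opuc n : [/\ size (opuc n) = n.+1, opuc n \is monic,
  (size (opucR n) <= n.+1)%N & (opucR n).[0] = 1].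
Proof.
elim: n => [|n [s1 m1 s2 h2]].
  by rewrite /opuc /opucR /= size_poly1 monic1 hornerE.
have sX : size ('X * opuc n) = n.+2.
  by rewrite mulrC size_mulX ?s1// -size_poly_eq0 s1.
have sc : (size (szego_coef n *: opucR n)%R < size ('X * opuc n)%R)%N.
  by rewrite sX ltnS (leq_trans (size_scale_leq _ _)).
rewrite opucS opucRS; split.
- by rewrite size_polyDl.
- by rewrite monicE lead_coefDl// -monicE monicMl ?monicX.
- rewrite (leq_trans (size_polyD _ _))// geq_max (leq_trans s2)//=.
  by rewrite (leq_trans (size_scale_leq _ _))// sX.
- by rewrite hornerD hornerZ hornerM hornerX mul0r mulr0 addr0.
Qed.

Lemma opucR_circle n x : (opucR n).[expi x] = expi x ^+ n * conjc (opuc n).[expi x].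
Proof.
elim: n => [|n IH].
  by rewrite /opuc /opucR /= !hornerE conjc1 ?mulr1.
rewrite opucS opucRS; move: (szego_coef n) => c.
rewrite !hornerE IH; move: (expi x) (expiJ x) => z e1.
rewrite rmorphD !rmorphM /= rmorphXn /= conjcK.
have en : conjc z ^+ n * z ^+ n = 1 by rewrite -exprMn mulrC e1 expr1n.
rewrite mulrDr; congr (_ + _).
  by rewrite exprS mulrACA e1 mul1r.
transitivity (conjc c * (z * (opuc n).[z]) * (conjc z ^+ n * z ^+ n)).
  by rewrite en mulr1 mulrA.
by rewrite exprS; ring.
Qed.

Lemma cabs_opucR n x : cabs (opucR n).[expi x] = cabs (opuc n).[expi x].
Proof.
rewrite opucR_circle cabsM cabs_conj.
suff -> : cabs (expi x ^+ n) = 1 by rewrite mul1r.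
by elim: n => [|n IH]; rewrite ?cabs1// exprS cabsM cabs_expi mul1r.
Qed.

Lemma opuc_neq0 n : opuc n != 0.
Proof. by rewrite -size_poly_eq0; have [-> _ _ _] := size_opuc n. Qed.

(** Write [<g, h>] for the integral of [g conj(h) f], [Phi] for [opuc n], [Psi] for its reversal and
    [W] for the squared norm. Reversal turns orthogonality of [Phi] to [1, ..., z^(n-1)] into that
    of [Psi] to [z, ..., z^n]; as [Psi(0) = 1], this gives [<Psi, 1> = <Psi, Psi> = W].
    Multiplication by [z] preserves the product, so [z Phi] is also orthogonal to [z, ..., z^n], and
    [c] is chosen to cancel the remaining product with 1. *)
Lemma opuc_orth_recursion n :
  (forall k, (k < n)%N -> wint (fun x => (opuc n).[expi x] * conjc (expi x ^+ k)) = 0) ->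
  [/\ forall k, (0 < k <= n)%N -> wint (fun x => (opucR n).[expi x] * conjc (expi x ^+ k)) = 0,
     wint (fun x => (opucR n).[expi x]) = (wnorm2 f (opuc n))%:C%C,
     forall k, (k <= n)%N -> wint (fun x => (opuc n.+1).[expi x] * conjc (expi x ^+ k)) = 0 &
     wnorm2 f (opuc n.+1) = wnorm2 f (opuc n) * (1 - cabs (szego_coef n) ^+ 2)].
Proof.
move=> orth; set c := szego_coef n.
have cp := ccont_poly (opuc n); have cq := ccont_poly (opucR n).
have W0 : (wnorm2 f (opuc n))%:C%C != 0 :> R[i].
  by rewrite (inj_eq (@complexI R)) gt_eqF// wnorm2_gt0// opuc_neq0.
have orthR k : (0 < k <= n)%N ->
    wint (fun x => (opucR n).[expi x] * conjc (expi x ^+ k)) = 0.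
  move=> /andP[k0 kn].
  have nk : (n - k < n)%N by rewrite ltn_subrL k0 (leq_trans k0 kn).
  rewrite -[RHS]conjc0 -(orth _ nk) -wintJ; last first.
    by apply: ccontM => //; apply: ccontJ; exact: ccont_expX.
  apply: eq_wint => x; rewrite opucR_circle.
  move: (expi x) (expiJ x) => z e1; move: (opuc n).[z] => w.
  have en : z ^+ n = z ^+ (n - k) * z ^+ k by rewrite -exprD subnK.
  have ek : z ^+ k * conjc (z ^+ k) = 1 by rewrite rmorphXn /= -exprMn e1 expr1n.
  rewrite en rmorphM /= conjcK.
  transitivity (z ^+ (n - k) * conjc w * (z ^+ k * conjc (z ^+ k))); first by rewrite -!mulrA [conjc w * _]mulrCA.
  by rewrite ek mulr1 mulrC.
have cexp k : ccont (fun x : R => conjc (expi x ^+ k)).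
  by apply: ccontJ; exact: ccont_expX.
have wR : wint (fun x => (opucR n).[expi x]) = (wnorm2 f (opuc n))%:C%C.
  rewrite -(wnorm2_eq _ _ (cabs_opucR n)) -wnorm2E.
  have [_ _ sR R0] := size_opuc n.
  rewrite (wint_conj_poly _ _ n.+1)// big_ord_recl big1 ?addr0 => [|i _].
    rewrite -horner_coef0 R0 conjc1 mul1r; apply: eq_wint => x.
    by rewrite mulr1.
  by rewrite orthR ?mulr0//= ltn_ord.
have eS x : (opuc n.+1).[expi x] = expi x * (opuc n).[expi x] + c * (opucR n).[expi x].
  by rewrite opucS !hornerE.
have cXp : ccont (fun x : R => expi x * (opuc n).[expi x]).
  by apply: ccontM => //; exact: ccont_expi.
have orthS k : (k <= n)%N ->
    wint (fun x => (opuc n.+1).[expi x] * conjc (expi x ^+ k)) = 0.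
  move=> kn.
  transitivity (wint (fun x => expi x * (opuc n).[expi x] * conjc (expi x ^+ k) +
     c * ((opucR n).[expi x] * conjc (expi x ^+ k)))).
    by apply: eq_wint => x; rewrite eS mulrDl mulrA.
  rewrite wintD ?wintZ; try by repeat apply: ccontM => //; exact: ccont_cst.
  case: k kn => [|k] kn.
    rewrite (_ : (fun x => _ * conjc (expi x ^+ 0)) = (fun x => expi x * (opuc n).[expi x])); last first.
      by apply/funext => x; rewrite expr0 conjc1 mulr1.
    rewrite (_ : (fun x => _ * conjc (expi x ^+ 0)) = (fun x => (opucR n).[expi x])); last first.
      by apply/funext => x; rewrite expr0 conjc1 mulr1.
    by rewrite wR /c /szego_coef divfK// addrN.
  rewrite orthR// mulr0 addr0 -[RHS](orth k kn); apply: eq_wint => x.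
  by rewrite exprS rmorphM /= mulrACA expiJ mul1r.
split => //.
have orthP r : (size r <= n.+1)%N -> wint (fun x => (opuc n.+1).[expi x] * conjc r.[expi x]) = 0.
  move=> sr; rewrite (wint_conj_poly _ _ n.+1)//; last exact: ccont_poly.
  by rewrite big1// => i _; rewrite orthS ?mulr0// -ltnS ltn_ord.
have [s1 _ sR _] := size_opuc n.
have cS := ccont_poly (opuc n.+1).
(* The new polynomial is orthogonal to [Psi], so its squared norm is its product with [z Phi],
   namely [W + c <Psi, z Phi>]. The same orthogonality gives [<z Phi, Psi> = - c W]. *)
apply: (@complexI R); rewrite -wnorm2E.
transitivity (wint (fun x => (opuc n.+1).[expi x] * conjc (expi x * (opuc n).[expi x]) +
   conjc c * ((opuc n.+1).[expi x] * conjc (opucR n).[expi x]))).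
  apply: eq_wint => x; rewrite {2}eS rmorphD /= mulrDr; congr (_ + _).
  by rewrite rmorphM /= mulrCA.
rewrite wintD; [|by apply: ccontM => //; apply: ccontJ|by apply: ccontM; [exact: ccont_cst|apply: ccontM => //; exact: ccontJ]].
rewrite wintZ; last by apply: ccontM => //; exact: ccontJ.
rewrite orthP// mulr0 addr0.
transitivity (wint (fun x => (opuc n).[expi x] * conjc (opuc n).[expi x] +
   c * conjc (expi x * (opuc n).[expi x] * conjc (opucR n).[expi x]))).
  apply: eq_wint => x; rewrite eS; move: (expi x) (expiJ x) => u e1.
  rewrite mulrDl rmorphM /= mulrACA e1 mul1r; congr (_ + _).
  have -> : conjc (u * (opuc n).[u] * conjc (opucR n).[u]) =
    conjc u * conjc (opuc n).[u] * (opucR n).[u] by rewrite !rmorphM /= conjcK.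
  by ring.
rewrite wintD; [|by apply: ccontM => //; exact: ccontJ|by apply: ccontM; [exact: ccont_cst|apply: ccontJ; apply: ccontM => //; exact: ccontJ]].
rewrite wnorm2E wintZ; last by apply: ccontJ; apply: ccontM => //; exact: ccontJ.
rewrite wintJ; last by apply: ccontM => //; exact: ccontJ.
have -> : wint (fun x => expi x * (opuc n).[expi x] * conjc (opucR n).[expi x]) =
    - c * (wnorm2 f (opuc n))%:C%C.
  have : wint (fun x => expi x * (opuc n).[expi x] * conjc (opucR n).[expi x] +
     c * ((opucR n).[expi x] * conjc (opucR n).[expi x])) = 0.
    by rewrite -[RHS](orthP _ sR); apply: eq_wint => x; rewrite eS mulrDl mulrA.
  rewrite wintD; [|by apply: ccontM => //; exact: ccontJ|by apply: ccontM; [exact: ccont_cst|apply: ccontM => //; exact: ccontJ]].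
  rewrite wintZ; last by apply: ccontM => //; exact: ccontJ.
  rewrite wnorm2E (wnorm2_eq _ _ (cabs_opucR n)) => /eqP.
  by rewrite addr_eq0 mulNr => /eqP.
have -> : conjc (- c * (wnorm2 f (opuc n))%:C%C) = - conjc c * (wnorm2 f (opuc n))%:C%C.
  by rewrite [LHS]rmorphM rmorphN; congr (_ * _); exact: conjc_real.
rewrite mulNr mulrN mulrA mulcJ -[_%:C%C * _]rmorphM -[LHS]rmorphB.
by congr (_%:C%C); ring.
Qed.

Lemma opuc_orth n k : (k < n)%N ->
  wint (fun x => (opuc n).[expi x] * conjc (expi x ^+ k)) = 0.
Proof.
elim: n k => [//|n IH] k kn.
by have [_ _ H _] := opuc_orth_recursion n IH; exact: H.
Qed.

Lemma wnorm2_opucS n :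
  wnorm2 f (opuc n.+1) = wnorm2 f (opuc n) * (1 - cabs (szego_coef n) ^+ 2).
Proof. by have [] := opuc_orth_recursion n (@opuc_orth n). Qed.

Lemma opuc_orth_poly n r : (size r <= n)%N ->
  wint (fun x => (opuc n).[expi x] * conjc r.[expi x]) = 0.
Proof.
move=> sr; rewrite (wint_conj_poly _ _ n)//; last exact: ccont_poly.
by rewrite big1// => i _; rewrite opuc_orth ?mulr0.
Qed.

Lemma size_monicB r n p : r \is monic -> size r = n.+1 -> p \is monic -> size p = n.+1 ->
  (size (r - p)%R <= n)%N.
Proof.
move=> mr sr mp sp; apply/leq_sizeP => j; rewrite leq_eqVlt => /predU1P[<-|nj].
  have := monicP mr; have := monicP mp; rewrite /lead_coef sr sp /= => hp hr.
  by rewrite coefB hp hr subrr.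
by rewrite coefB !nth_default ?subrr// ?sr ?sp.
Qed.

(** Pythagoras: [r - opuc n] has degree below [n], hence is orthogonal to [opuc n]. *)
Lemma wnorm2_opuc_min r n : r \is monic -> size r = n.+1 -> wnorm2 f (opuc n) <= wnorm2 f r.
Proof.
move=> mr sr; have [s1 m1 _ _] := size_opuc n.
have sd := size_monicB r n (opuc n) mr sr m1 s1.
set d := r - opuc n in sd.
have cp := ccont_poly (opuc n); have cd := ccont_poly d.
suff -> : wnorm2 f r = wnorm2 f (opuc n) + wnorm2 f d by rewrite lerDl wnorm2_ge0.
apply: (@complexI R); rewrite rmorphD /= -!wnorm2E.
have c1 : ccont (fun x => (opuc n).[expi x] * conjc d.[expi x]).
  by apply: ccontM => //; exact: ccontJ.
have c2 : ccont (fun x => d.[expi x] * conjc d.[expi x]).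
  by apply: ccontM => //; exact: ccontJ.
have c3 : ccont (fun x => (opuc n).[expi x] * conjc (opuc n).[expi x]).
  by apply: ccontM => //; exact: ccontJ.
transitivity (wint (fun x => ((opuc n).[expi x] * conjc (opuc n).[expi x] +
   d.[expi x] * conjc d.[expi x]) + ((opuc n).[expi x] * conjc d.[expi x] +
   conjc ((opuc n).[expi x] * conjc d.[expi x])))).
  apply: eq_wint => x; have -> : r = opuc n + d by rewrite /d addrC subrK.
  by rewrite hornerD rmorphD rmorphM /= conjcK; ring.
rewrite wintD; [|exact: ccontD|by apply: ccontD => //; exact: ccontJ].
rewrite !wintD//; last exact: ccontJ.
by rewrite wintJ// (opuc_orth_poly n d)// rmorph0 !addr0.
Qed.

(** [monic_OP] is chosen by [xget], so uniqueness has to be proved: the difference of two candidates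
    has degree below [n] and is orthogonal to all lower powers, hence to itself. *)
Lemma monic_OP_opuc n : monic_OP f n = opuc n.
Proof.
have [s1 m1 _ _] := size_opuc n.
apply: xget_unique.
  by split => //; split => // k kn; rewrite -[RHS](opuc_orth n k kn).
move=> r [mr [sr orth]]; apply/eqP; rewrite -subr_eq0; apply: contraT => d0.
have sd := size_monicB r n (opuc n) mr sr m1 s1.
have := wnorm2_gt0 _ d0; set d := r - opuc n in sd d0 *.
suff : (wnorm2 f d)%:C%C = 0 :> R[i] by move=> -[->]; rewrite ltxx.
rewrite -wnorm2E (wint_conj_poly _ _ n)//; last exact: ccont_poly.
rewrite big1// => i _; suff -> : wint (fun x => d.[expi x] * conjc (expi x ^+ i)) = 0 by rewrite mulr0.
have cexp : ccont (fun x : R => conjc (expi x ^+ i)).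
  by apply: ccontJ; exact: ccont_expX.
transitivity (wint (fun x => r.[expi x] * conjc (expi x ^+ i) +
   (-1) * ((opuc n).[expi x] * conjc (expi x ^+ i)))).
  by apply: eq_wint => x; rewrite hornerD hornerN mulrDl mulN1r mulNr.
have cr := ccont_poly r; have cp := ccont_poly (opuc n).
rewrite wintD; [|exact: ccontM|by apply: ccontM; [exact: ccont_cst|exact: ccontM]].
rewrite wintZ; last exact: ccontM.
by rewrite opuc_orth// mulr0 addr0; exact: orth.
Qed.

(** Evaluate the recursion at 0, where the reversed polynomial is 1. The coefficient of step [n]
    thus corresponds to index [n + 1]. *)
Lemma cabs_verblunskyS n : cabs (verblunsky f n.+1) = cabs (szego_coef n).
Proof.
rewrite /verblunsky monic_OP_opuc cabsN cabs_conj opucS.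
have [_ _ _ R0] := size_opuc n.
by rewrite hornerD hornerZ R0 mulr1 hornerM hornerX mul0r add0r.
Qed.

Lemma wnorm2_verblunsky n :
  wnorm2 f (opuc n.+1) = wnorm2 f (opuc n) * (1 - cabs (verblunsky f n.+1) ^+ 2).
Proof. by rewrite cabs_verblunskyS wnorm2_opucS. Qed.

End Szego.

(** * Vandermonde products *)

Section Vandermonde.
Context {R : realType}.
Notation mu := (@lebesgue_measure R).

Definition vprod n (z : 'I_n -> R[i]) : R :=
  \prod_(j < n) \prod_(k < n | (j < k)%N) cabs (z j - z k).

Lemma vprod_ge0 n (z : 'I_n -> R[i]) : 0 <= vprod n z.
Proof. by apply: prodr_ge0 => j _; apply: prodr_ge0 => k _; exact: cabs_ge0. Qed.

Lemma vprod_nat n (z : nat -> R[i]) :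
  vprod n (fun i => z i) = \prod_(k < n) \prod_(j < k) cabs (z j - z k).
Proof.
rewrite /vprod (exchange_big_dep xpredT)//=; apply: eq_bigr => k _.
by rewrite (big_ord_widen n (fun j => cabs (z j - z k)))// ltnW.
Qed.

(** The coefficient matrix [L] is triangular with unit diagonal, so passing from powers to a monic
    basis preserves the Vandermonde determinant. *)
Lemma det_monic_basis n (z : 'I_n -> R[i]) (p : nat -> {poly R[i]}) :
  (forall k, p k \is monic) -> (forall k, size (p k) = k.+1) ->
  \det (\matrix_(k < n, j < n) (p k).[z j]) = \prod_(i < n) \prod_(j < n | (i < j)%N) (z j - z i).
Proof.
move=> mp sp.
pose L : 'M[R[i]]_n := \matrix_(k < n, i < n) (p k)`_i.
have -> : \matrix_(k < n, j < n) (p k).[z j] = L *m Vandermonde n (\row_j z j).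
  apply/matrixP => k j; rewrite !mxE (@horner_coef_wide _ n); last by rewrite sp.
  by apply: eq_bigr => i _; rewrite !mxE.
rewrite det_mulmx det_Vandermonde det_trig.
  rewrite big1 ?mul1r => [|i _].
    by apply: eq_bigr => i _; apply: eq_bigr => j _; rewrite !mxE.
  by rewrite mxE; have /monicP := mp i; rewrite /lead_coef sp.
by apply/is_trig_mxP => i j ij; rewrite mxE nth_default// sp.
Qed.

Lemma cabs_det_le n (A : 'M[R[i]]_n) (M : 'I_n -> R) :
  (forall i j, cabs (A i j) <= M i) -> cabs (\det A) <= (n`!)%:R * \prod_(i < n) M i.
Proof.
move=> AM; apply: (le_trans (cabs_sum _ _ _ _)).
apply: (@le_trans _ _ (\sum_(s : 'S_n) \prod_(i < n) M i)).
  apply: ler_sum => s _; rewrite cabsM cabs_prod.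
  have -> : cabs ((-1) ^+ s : R[i]) = 1.
    by case: (odd_perm s); rewrite ?expr1 ?expr0 ?cabsN cabs1.
  by rewrite mul1r; apply: ler_prod => i _; rewrite cabs_ge0 AM.
by rewrite sumr_const card_Sn mulr_natl.
Qed.

Lemma vprod_le n (z : 'I_n -> R[i]) (p : nat -> {poly R[i]}) (M : nat -> R) :
  (forall k, p k \is monic) -> (forall k, size (p k) = k.+1) ->
  (forall (k : nat) j, (k < n)%N -> cabs (p k).[z j] ^+ 2 <= M k) ->
  vprod n z ^+ 2 <= (n`!)%:R ^+ 2 * \prod_(k < n) M k.
Proof.
move=> mp sp pM.
have M0 (k : 'I_n) : 0 <= M k by rewrite (le_trans (sqr_ge0 _) (pM k k (ltn_ord k))).
have -> : \prod_(k < n) M k = (\prod_(k < n) Num.sqrt (M k)) ^+ 2.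
  by rewrite -prodrXl; apply: eq_bigr => k _; rewrite sqr_sqrtr.
rewrite -exprMn ler_pXn2r ?nnegrE ?vprod_ge0//; last first.
  by rewrite mulr_ge0// prodr_ge0// => k _; exact: sqrtr_ge0.
have -> : vprod n z = cabs (\det (\matrix_(k < n, j < n) (p k).[z j])).
  rewrite det_monic_basis// cabs_prod; apply: eq_bigr => j _.
  by rewrite cabs_prod; apply: eq_bigr => k _; rewrite cabsB.
apply: cabs_det_le => i j; rewrite mxE.
rewrite -(@ler_pXn2r _ 2) ?nnegrE ?cabs_ge0 ?sqrtr_ge0// sqr_sqrtr//.
exact: pM.
Qed.

Variables (f : R -> R) (sf : spectral_density f).
Let W n := wnorm2 f (opuc f n).

Lemma wnorm2_opuc_gt0 n : 0 < W n.
Proof. by apply: wnorm2_gt0 => //; exact: opuc_neq0. Qed.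

Lemma wnorm2_opuc0 : W 0 = Rintegral mu (@Lam R) f.
Proof.
rewrite /W /wnorm2; apply: eq_Rintegral => x _.
by rewrite /opuc /= hornerE cabs1 expr1n mul1r.
Qed.

(** Otherwise integration against [f], which vanishes on [Lam] off [Ef f] and has total mass [W 0],
    would give [wnorm2 f q <= W n / 2], against minimality. The factor 2 makes this weak inequality
    contradictory. *)
Lemma monic_large_value n q : q \is monic -> size q = n.+1 ->
  exists2 w, Ef f w & W n / (2 * W 0) <= cabs q.[w] ^+ 2.
Proof.
move=> mq sq; apply: contrapT => H.
have small w : Ef f w -> cabs q.[w] ^+ 2 < W n / (2 * W 0).
  by move=> Ew; rewrite ltNge; apply/negP => h; apply: H; exists w.
have W00 := wnorm2_opuc_gt0 0; have Wn := wnorm2_opuc_gt0 n.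
have [f0 [fi _]] := sf.
have : wnorm2 f q <= Rintegral mu (@Lam R) (fun x => W n / (2 * W 0) * f x).
  apply: le_Rintegral.
  - exact: measurable_Lam.
  - exact: wnorm2_integrable.
  - apply: (@weighted_integrable _ _ sf (fun=> W n / (2 * W 0))); exact: cst_continuous.
  - move=> x Lx; have := f0 x Lx; rewrite le_eqVlt => /predU1P[<-|fx]; first by rewrite !mulr0.
    rewrite ler_pM2r//; apply/ltW/small; exists x => //.
have -> : Rintegral mu (@Lam R) (fun x => W n / (2 * W 0) * f x) = W n / 2.
  rewrite RintegralZl//; last exact: measurable_Lam.
  by rewrite -wnorm2_opuc0; field; rewrite gt_eqF.
have := wnorm2_opuc_min _ sf q n mq sq; rewrite -/(W n) => h1 h2.
have := le_trans h1 h2; lra.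
Qed.

(** Adding [w] multiplies the Vandermonde product by [|q(w)|], where [q] is the monic polynomial
    with zeros at the previous points. *)
Lemma leja_points n : exists2 z : nat -> R[i], (forall i, Ef f (z i)) &
  \prod_(k < n) (W k / (2 * W 0)) <= vprod n (fun i => z i) ^+ 2.
Proof.
elim: n => [|n [z Ez IH]].
  (* Degree 0 serves only to exhibit a point of [Ef f]. *)
  have [w Ew _] := monic_large_value 0 1 (monic1 _) (size_poly1 _).
  by exists (fun=> w) => //; rewrite vprod_nat !big_ord0 expr1n.
pose q : {poly R[i]} := \prod_(j < n) ('X - (z j)%:P).
have mq : q \is monic by exact: monic_prod_XsubC.
have sq : size q = n.+1 by rewrite size_prod_XsubC [index_enum _]unlock /= -enumT size_enum_ord.
have [w Ew hw] := monic_large_value n q mq sq.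
exists (fun i => if (i < n)%N then z i else w); first by move=> i; case: ifP.
rewrite (vprod_nat n.+1 (fun i => if (i < n)%N then z i else w)).
rewrite big_ord_recr [in leRHS]big_ord_recr /= ltnn exprMn.
apply: ler_pM.
- by apply: prodr_ge0 => k _; rewrite divr_ge0 ?mulr_ge0// ltW ?wnorm2_opuc_gt0.
- by rewrite divr_ge0 ?mulr_ge0// ltW ?wnorm2_opuc_gt0.
- rewrite vprod_nat in IH; apply: (le_trans IH).
  rewrite le_eqVlt; apply/orP; left; apply/eqP; congr (_ ^+ 2).
  apply: eq_bigr => k _; apply: eq_bigr => j _.
  by rewrite ltn_ord (ltn_trans (ltn_ord j) (ltn_ord k)).
- apply: (le_trans hw); rewrite horner_prod cabs_prod.
  rewrite le_eqVlt; apply/orP; left; apply/eqP; congr (_ ^+ 2).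
  by apply: eq_bigr => j _; rewrite ltn_ord hornerXsubC cabsB.
Qed.

End Vandermonde.

(** * Elementary growth estimates *)

Section Asymptotics.
Context {R : realType}.
Implicit Types (u : nat -> R).

Lemma bin2_double n : (n * n.-1 = 'C(n, 2).*2)%N.
Proof. by have := mul_bin_diag n 1; rewrite bin1 mul2n. Qed.

Lemma prod_powers (a : R) n : \prod_(k < n) a ^+ k = a ^+ 'C(n, 2).
Proof. by rewrite -expr_sum -bin2_sum big_mkord. Qed.

(** [A] dominates [u k / r^k] for the finitely many [k <= k0]; the ratio bound propagates the
    estimate from there. *)
Lemma geometric_bound u (r : R) (k0 : nat) : (forall k, 0 < u k) -> 0 < r ->
  (forall k, (k0 <= k)%N -> u k.+1 <= r * u k) ->
  exists2 A, 0 < A & forall k, u k <= A * r ^+ k.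
Proof.
move=> u0 r0 ur; pose A := \sum_(k < k0.+1) u k / r ^+ k.
have Ale (k : nat) : (k <= k0)%N -> u k <= A * r ^+ k.
  move=> kk; rewrite -ler_pdivrMr ?exprn_gt0// /A.
  rewrite (bigD1 (Ordinal (kk : k < k0.+1)%N))//= lerDl.
  by apply: sumr_ge0 => i _; rewrite divr_ge0 ?exprn_ge0 ?ltW.
exists A.
  have := Ale 0%N (leq0n _); rewrite expr0 mulr1; exact: lt_le_trans.
elim=> [|k IH]; first exact: Ale.
have [kk|kk] := leqP k.+1 k0; first exact: Ale.
by rewrite exprS mulrCA (le_trans (ur k kk))// ler_wpM2l// ltW.
Qed.

Lemma bernoulli (h : R) n : 0 <= h -> 1 + n%:R * h <= (1 + h) ^+ n.
Proof.
move=> h0; elim: n => [|n IH]; first by rewrite expr0 mul0r addr0.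
rewrite exprS -[n.+1%:R]natr1.
apply: (@le_trans _ _ ((1 + h) * (1 + n%:R * h))); last by rewrite ler_wpM2l// addr_ge0.
have : 0 <= n%:R * h ^+ 2 by rewrite mulr_ge0 ?sqr_ge0.
by rewrite expr2 => h2; nra.
Qed.

Lemma exp_dominates (g D : R) : 1 < g ->
  \forall n \near \oo, D <= g ^+ n.-1.
Proof.
move=> g1; have h0 : 0 < g - 1 by rewrite subr_gt0.
have [N hN] : exists N : nat, D / (g - 1) <= N%:R.
  exists (Num.bound `|D / (g - 1)|); apply: (le_trans (ler_norm _)).
  by apply/ltW/archi_boundP.
exists N.+1 => // n /= Nn.
have e : 1 + (g - 1) = g by ring.
have := @bernoulli (g - 1) n.-1 (ltW h0); rewrite e.
apply: le_trans; rewrite ler_wpDl// -ler_pdivrMr// (le_trans hN)// ler_nat.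
by rewrite -ltnS prednK// (leq_trans _ Nn).
Qed.

(** Bernoulli's inequality gives linear growth for each factor [g ^+ n.-1]; three factors give cubic
    growth, which beats [n^2 D]. *)
Lemma exp_dominates_sqr (g D : R) : 1 < g -> 0 <= D ->
  \forall n \near \oo, n%:R ^+ 2 * D <= (g ^+ 3) ^+ n.-1.
Proof.
move=> g1 D0; have h0 : 0 < g - 1 by rewrite subr_gt0.
have [N hN] : exists N : nat, 4 * D / (g - 1) ^+ 3 <= N%:R.
  exists (Num.bound `|4 * D / (g - 1) ^+ 3|); apply: (le_trans (ler_norm _)).
  by apply/ltW/archi_boundP.
exists N.+2 => // -[//|[//|n]] /= Nn.
set x : R := n.+1%:R.
have x1 : 1 <= x by rewrite ler1n.
have n2 : n.+2%:R <= 2 * x by rewrite -natr1 -/x; lra.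
have xN : 4 * D <= x * (g - 1) ^+ 3.
  rewrite -ler_pdivrMr ?exprn_gt0// (le_trans hN)// ler_nat.
  by rewrite ltnS in Nn; exact: ltnW.
apply: (@le_trans _ _ ((x * (g - 1)) ^+ 3)).
  apply: (@le_trans _ _ ((2 * x) ^+ 2 * D)).
    by rewrite ler_wpM2r// ler_pXn2r ?nnegrE// mulr_ge0//; lra.
  have x20 : 0 <= x ^+ 2 by rewrite sqr_ge0.
  have := ler_wpM2l x20 xN; congr (_ <= _); ring.
rewrite exprAC ler_pXn2r ?nnegrE ?mulr_ge0 ?exprn_ge0 ?ltW//; [|lra].
have e : 1 + (g - 1) = g by ring.
have := @bernoulli (g - 1) n.+1 (ltW h0); rewrite e -/x; lra.
Qed.

Lemma fact_le_expn n : (n`! <= n ^ n)%N.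
Proof.
elim: n => [//|n IH]; rewrite factS expnS leq_mul2l /=.
by have [->//|n0] := posnP n; rewrite (leq_trans IH)// leq_exp2r.
Qed.

Lemma exists_gt1_exprM_lt (Q B : R) (N : nat) : Q < B -> exists2 g : R, 1 < g & g ^+ N * Q < B.
Proof.
move=> QB.
have c : (fun g : R => g ^+ N * Q) @ (1 : R)^'+ --> 1 ^+ N * Q.
  apply: cvg_at_right_filter; apply: cvgM; last exact: cvg_cst.
  exact: exprn_continuous.
have H1 : \forall g \near (1 : R)^'+, g ^+ N * Q < B.
  by apply: (cvgr_lt _ c); rewrite expr1n mul1r.
have H2 : \forall g \near (1 : R)^'+, 1 < g by exact: nbhs_right_gt.
by have [g [h1 h2]] := filter_ex (filterI H1 H2); exists g.
Qed.

End Asymptotics.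

(** * The transfinite diameter *)

Section Diameter.
Context {R : realType}.
Notation mu := (@lebesgue_measure R).

Lemma powR_expn_root (b : R) n : (1 < n)%N -> 0 <= b ->
  (b ^+ 'C(n, 2)) `^ (2 / (n * n.-1)%:R) = b.
Proof.
move=> n1 b0; have m0 : 'C(n, 2)%:R != 0 :> R by rewrite pnatr_eq0 -lt0n bin_gt0.
have -> : 2 / (n * n.-1)%:R = ('C(n, 2)%:R)^-1 :> R.
  by rewrite bin2_double -mul2n natrM invfM mulrA divff ?mul1r.
by rewrite -powR_mulrn// -powRrM divff// powRr1.
Qed.

(** Bounds on [sup] need a set bounded above, for the lower estimate, and a nonempty one, for the
    upper: [K] and [w] provide these. *)
Lemma diam_bounds (F : set R[i]) n (K : R) : (1 < n)%N ->
  (forall z : 'I_n -> R[i], (forall i, F (z i)) -> vprod n z <= K) ->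
  (forall b (z : 'I_n -> R[i]), 0 <= b -> (forall i, F (z i)) ->
    b ^+ 'C(n, 2) <= vprod n z -> b <= diam_n F n) /\
  (forall b w, 0 <= b -> F w ->
    (forall z : 'I_n -> R[i], (forall i, F (z i)) -> vprod n z <= b ^+ 'C(n, 2)) ->
    diam_n F n <= b).
Proof.
move=> n1 VK.
have e0 : 0 <= 2 / (n * n.-1)%:R :> R by rewrite divr_ge0.
have mono (x y : R) : 0 <= x -> x <= y ->
    x `^ (2 / (n * n.-1)%:R) <= y `^ (2 / (n * n.-1)%:R).
  by move=> x0 xy; apply: ge0_ler_powR => //; rewrite nnegrE// (le_trans x0).
split=> [b z b0 Fz bz|b w b0 Fw H].
  apply: (@le_trans _ _ (vprod n z `^ (2 / (n * n.-1)%:R))).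
    by rewrite -{1}(powR_expn_root b n n1 b0); apply: mono; rewrite ?exprn_ge0.
  apply: sup_ubound; last by exists z.
  exists (K `^ (2 / (n * n.-1)%:R)) => _ [y Fy <-].
  by apply: mono; [exact: vprod_ge0|exact: VK].
apply: ge_sup; first by exists (vprod n (fun=> w) `^ (2 / (n * n.-1)%:R)); exists (fun=> w).
move=> _ [y Fy <-]; rewrite -(powR_expn_root b n n1 b0).
by apply: mono; [exact: vprod_ge0|exact: H].
Qed.

Variables (f : R -> R) (sf : spectral_density f)
  (arcs : finite_union_closed_arcs (clEf f))
  (aef : {ae mu, forall x, Lam x -> clEf f (expi x) -> 0 < f x}).
Let W n := wnorm2 f (opuc f n).
Let v n := cabs (verblunsky f n).
Let F := clEf f.

Lemma Ef_clEf w : Ef f w -> F w.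
Proof. by move=> Ew e e0; exists w => //; rewrite subrr /cabs Normc.normc0. Qed.

Lemma vprod_upper (c : R) : 1 < c -> exists2 C, 0 < C &
  forall n (z : 'I_n -> R[i]), (forall i, F (z i)) ->
    vprod n z ^+ 2 <= (n`!)%:R ^+ 2 * \prod_(k < n) (C * c ^+ k * W k).
Proof.
move=> c1; have [C C0 HC] := weak_remez f c sf arcs aef c1.
(* Degree [k] means size [k + 1], so [weak_remez] yields [c ^+ k.+1]; the extra [c] goes into the
   constant. *)
exists (C * c); first by rewrite mulr_gt0//; lra.
move=> n z Fz; apply: (vprod_le n z (opuc f) (fun k => C * c * c ^+ k * W k)).
- by move=> k; have [] := size_opuc f k.
- by move=> k; have [] := size_opuc f k.
move=> k j kn; have [sk _ _ _] := size_opuc f k.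
have := HC k.+1 (opuc f k) (z j) isT; rewrite sk => /(_ (leqnn _)).
by rewrite [c ^+ k.+1]exprS mulrA; apply; [exact: wnorm2_opuc_gt0|exact: Fz].
Qed.

Variables (L : R) (vL : v @ \oo --> L).

(** Positivity of [W (n + 1) = W n (1 - v (n + 1)^2)] forces [v (n + 1) < 1]. The recursion reaches
    positive indices only, hence the shift. *)
Lemma verblunsky_lim_bounds : 0 <= L <= 1.
Proof.
have v01 n : 0 <= v n.+1 <= 1.
  rewrite cabs_ge0 /=; have := wnorm2_opuc_gt0 f sf n.+1.
  rewrite wnorm2_verblunsky// pmulr_rgt0; last exact: wnorm2_opuc_gt0.
  rewrite subr_gt0 -/(v n.+1) => h.
  by rewrite -(@expr_le1 _ 2)// ?cabs_ge0// ltW.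
have vL' : v n.+1 @[n --> \oo] --> L by rewrite (cvg_shiftS v).
apply/andP; split.
- by apply: (cvgr_to_ge vL'); apply: nearW => n; have /andP[] := v01 n.
- by apply: (cvgr_to_le vL'); apply: nearW => n; have /andP[] := v01 n.
Qed.

Lemma ratio_cvg : (fun n => 1 - v n ^+ 2) @ \oo --> 1 - L ^+ 2.
Proof. by apply: cvgB; [exact: cvg_cst|apply: cvgM]. Qed.

Lemma wnorm2_opuc_upper a : 0 < a -> 1 - L ^+ 2 < a ->
  exists2 A, 0 < A & forall k, W k <= A * a ^+ k.
Proof.
move=> a0 La; have [k0 _ Hk0] := cvgr_lt (1 - L ^+ 2) ratio_cvg a La.
apply: (@geometric_bound _ W a k0) => // [k|k kk]; first exact: wnorm2_opuc_gt0.
rewrite /W wnorm2_verblunsky// mulrC ler_pM2r; last exact: wnorm2_opuc_gt0.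
by apply/ltW/(Hk0 k.+1) => /=; rewrite (leq_trans kk).
Qed.

Lemma wnorm2_opuc_lower a : 0 < a -> a < 1 - L ^+ 2 ->
  exists2 A, 0 < A & forall k, A * a ^+ k <= W k.
Proof.
move=> a0 La; have [k0 _ Hk0] := cvgr_gt (1 - L ^+ 2) ratio_cvg a La.
have W0 k : 0 < W k by exact: wnorm2_opuc_gt0.
(* A lower bound for [W] is an upper bound for its inverse. *)
have [|||A A0 HA] := @geometric_bound _ (fun k => (W k)^-1) a^-1 k0.
- by move=> k; rewrite invr_gt0.
- by rewrite invr_gt0.
- move=> k kk; rewrite -invfM lef_pV2 ?posrE ?mulr_gt0//.
  rewrite [leRHS]wnorm2_verblunsky// -/(W k) mulrC ler_pM2l//.
  by apply/ltW/(Hk0 k.+1) => /=; rewrite (leq_trans kk).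
exists A^-1; first by rewrite invr_gt0.
move=> k; have := HA k; rewrite exprVn -[A * _]invrK lef_pV2 ?posrE ?invr_gt0 ?mulr_gt0 ?invr_gt0 ?exprn_gt0//.
by rewrite invfM invrK.
Qed.

Lemma vprod_bounded n : exists K : R, forall z : 'I_n -> R[i], (forall i, F (z i)) -> vprod n z <= K.
Proof.
have [C _ HC] := vprod_upper 2 ltac:(lra).
exists (1 + (n`!)%:R ^+ 2 * \prod_(k < n) (C * 2 ^+ k * W k)) => z Fz.
have := HC n z Fz; have := vprod_ge0 n z; nra.
Qed.

Lemma diam_upper b : 0 < b -> 1 - L ^+ 2 < b ^+ 2 -> \forall n \near \oo, diam_n F n <= b.
Proof.
(* 12 is [6 + 6]: one [g^6] is the constant [c] of the Remez bound, the other absorbs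
   [(n!)^2 D^n]. *)
move=> b0 Lb; have [g g1 gb] := exists_gt1_exprM_lt _ _ 12 Lb.
have g0 : 0 < g by rewrite (lt_trans ltr01).
have g12 : 0 < g ^+ 12 by rewrite exprn_gt0.
pose a := b ^+ 2 / g ^+ 12.
have a0 : 0 < a by rewrite divr_gt0 ?exprn_gt0.
have La : 1 - L ^+ 2 < a by rewrite ltr_pdivlMr// mulrC.
have [A A0 HA] := wnorm2_opuc_upper a a0 La.
have c1 : 1 < g ^+ 6 by rewrite exprn_egt1.
have [C C0 HC] := vprod_upper _ c1.
have [D DE D0] : exists2 D, D = C * A & 0 < D by exists (C * A) => //; rewrite mulr_gt0.
have [N _ HN] := exp_dominates_sqr g D g1 (ltW D0).
exists N.+2 => // n /= Nn.
have n1 : (1 < n)%N by rewrite (leq_trans _ Nn).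
have [K HK] := vprod_bounded n.
have [_ le_diam] := diam_bounds F n K n1 HK.
have [z Ez _] := leja_points f sf 1.
apply: (le_diam b (z 0%N)); [exact: ltW|exact: Ef_clEf|].
move=> {Ez}{}z Fz.
rewrite -(@ler_pXn2r _ 2) ?nnegrE ?vprod_ge0 ?exprn_ge0 ?(ltW b0)//.
apply: (le_trans (HC n z Fz)).
have p1 : \prod_(k < n) (C * (g ^+ 6) ^+ k * W k) <= D ^+ n * (g ^+ 6 * a) ^+ 'C(n, 2).
  rewrite -prod_powers -[X in D ^+ X]card_ord -prodr_const -big_split /=.
  apply: ler_prod => k _; apply/andP; split.
    by rewrite mulr_ge0 ?mulr_ge0 ?exprn_ge0 ?ltW//; exact: wnorm2_opuc_gt0.
  have -> : D * (g ^+ 6 * a) ^+ k = C * (g ^+ 6) ^+ k * (A * a ^+ k).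
    by rewrite exprMn DE; ring.
  by apply: ler_wpM2l => //; rewrite mulr_ge0 ?exprn_ge0 ?ltW.
have f2 : 0 <= (n`!)%:R ^+ 2 :> R by rewrite exprn_ge0.
apply: (le_trans (ler_wpM2l f2 p1)).
have ga0 : 0 <= (g ^+ 6 * a) ^+ 'C(n, 2) by rewrite exprn_ge0// mulr_ge0 ?exprn_ge0 ?ltW.
(* [n! <= n^n] leads to [(n^2 D)^n], and [(g^3)^(n(n-1))] is [(g^6)^'C(n, 2)]. *)
have p2 : (n`!)%:R ^+ 2 * D ^+ n <= (g ^+ 6) ^+ 'C(n, 2).
  apply: (@le_trans _ _ ((n%:R ^+ 2 * D) ^+ n)).
    rewrite [(_ * D) ^+ n]exprMn ler_wpM2r ?exprn_ge0 ?(ltW D0)// exprAC ler_pXn2r ?nnegrE ?exprn_ge0//.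
    by rewrite -natrX ler_nat fact_le_expn.
  apply: (@le_trans _ _ (((g ^+ 3) ^+ n.-1) ^+ n)).
    rewrite ler_pXn2r ?nnegrE ?mulr_ge0 ?exprn_ge0 ?(ltW D0) ?(ltW g0) ?(ltnW n1)//.
    by apply: HN => /=; rewrite (leq_trans _ Nn)// -addn2 leq_addr.
  rewrite -!exprM [(n.-1 * n)%N]mulnC bin2_double -mul2n mulnA.
  by rewrite lexx.
rewrite mulrA; apply: (le_trans (ler_wpM2r ga0 p2)).
rewrite -exprMn exprAC (_ : g ^+ 6 * (g ^+ 6 * a) = b ^+ 2)//.
by rewrite /a; field; rewrite gt_eqF.
Qed.

Lemma diam_lower b : 0 < b -> b ^+ 2 < 1 - L ^+ 2 -> \forall n \near \oo, b <= diam_n F n.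
Proof.
(* The exponent 2 comes from [D^n (g^2)^'C(n, 2) = (D g^(n-1))^n], which is at least 1 for large
   [n]. *)
move=> b0 Lb; have [g g1 gb] := exists_gt1_exprM_lt _ _ 2 Lb.
have g0 : 0 < g by rewrite (lt_trans ltr01).
pose a := g ^+ 2 * b ^+ 2.
have a0 : 0 < a by rewrite mulr_gt0 ?exprn_gt0.
have [A A0 HA] := wnorm2_opuc_lower a a0 gb.
pose W2 := 2 * W 0; have W20 : 0 < W2 by rewrite mulr_gt0//; exact: wnorm2_opuc_gt0.
have [D DE D0] : exists2 D, D = A / W2 & 0 < D by exists (A / W2) => //; rewrite divr_gt0.
have [N _ HN] := exp_dominates g D^-1 g1.
exists N.+2 => // n /= Nn.
have n1 : (1 < n)%N by rewrite (leq_trans _ Nn).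
have [K HK] := vprod_bounded n.
have [ge_diam _] := diam_bounds F n K n1 HK.
have [z Ez Vz] := leja_points f sf n.
apply: (ge_diam b (fun i => z i)); [exact: ltW|by move=> i; exact: Ef_clEf|].
rewrite -(@ler_pXn2r _ 2) ?nnegrE ?vprod_ge0 ?exprn_ge0 ?(ltW b0)//.
apply: le_trans Vz.
have p1 : D ^+ n * a ^+ 'C(n, 2) <= \prod_(k < n) (W k / W2).
  rewrite -prod_powers -[X in D ^+ X]card_ord -prodr_const -big_split /=.
  apply: ler_prod => k _; apply/andP; split.
    by rewrite mulr_ge0 ?exprn_ge0 ?ltW.
  by rewrite DE mulrAC ler_pM2r ?invr_gt0.
apply: le_trans p1.
have p2 : 1 <= D ^+ n * (g ^+ 2) ^+ 'C(n, 2).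
  rewrite -exprM mul2n -bin2_double mulnC exprM -exprMn.
  rewrite exprn_ege1// mulrC -ler_pdivrMr// div1r.
  by apply: HN => /=; rewrite (leq_trans _ Nn)// -addn2 leq_addr.
by rewrite /a exprMn mulrA exprAC ler_peMl// !exprn_ge0// ltW.
Qed.

Lemma diam_cvg : diam_n F n @[n --> \oo] --> Num.sqrt (1 - L ^+ 2).
Proof.
have /andP[L0 L1] := verblunsky_lim_bounds.
have Q0 : 0 <= 1 - L ^+ 2 by rewrite subr_ge0 expr_le1.
set Q := Num.sqrt _; have Q2 : Q ^+ 2 = 1 - L ^+ 2 by rewrite sqr_sqrtr.
have Qge : 0 <= Q by rewrite sqrtr_ge0.
apply/cvgrPdist_lt => e e0.
have up : \forall n \near \oo, diam_n F n <= Q + e / 2.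
  by apply: diam_upper; [lra|rewrite -Q2; nra].
have low : \forall n \near \oo, Q - e / 2 <= diam_n F n.
  (* [diam_lower] needs a positive bound. If [Q - e / 2 <= 0], as always when [L = 1], nonnegativity
     of the diameters is enough; it is the case [b = 0], where [n > 1] makes [0 ^+ 'C(n, 2)]
     vanish. *)
  have [h|h] := leP (Q - e / 2) 0; last by apply: diam_lower => //; rewrite -Q2; nra.
  exists 2%N => // n /= n1; apply: (le_trans h).
  have [K HK] := vprod_bounded n.
  have [ge_diam _] := diam_bounds F n K n1 HK.
  have [z Ez _] := leja_points f sf n.
  apply: (ge_diam 0 (fun i => z i)) => //; first by move=> i; exact: Ef_clEf.
  by rewrite expr0n eqn0Ngt bin_gt0 n1 vprod_ge0.
near=> n.
have h1 : diam_n F n <= Q + e / 2 by near: n.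
have h2 : Q - e / 2 <= diam_n F n by near: n.
rewrite ltr_norml; apply/andP; split; lra.
Unshelve. all: by end_near.
Qed.

End Diameter.

Theorem mainTheorem4 (R : realType) (f : R -> R) :
  spectral_density f ->
  finite_union_closed_arcs (clEf f) ->
  {ae (@lebesgue_measure R), forall x, Lam x -> clEf f (expi x) -> 0 < f x} ->
  cvg ((fun n => cabs (verblunsky f n)) @ \oo) ->
  lim ((fun n => cabs (verblunsky f n)) @ \oo) =
    Num.sqrt (1 - transfinite_diameter (clEf f) ^+ 2).
Proof.
move=> sf arcs aef vcvg; set L := lim _.
have /andP[L0 L1] := verblunsky_lim_bounds f sf L vcvg.
rewrite /transfinite_diameter (cvg_lim _ (diam_cvg f sf arcs aef L vcvg))//.
(* [L <= 1] makes the inner radicand nonnegative, and [0 <= L] identifies [L] with the square root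
   of [L^2]. *)
rewrite sqr_sqrtr ?subr_ge0 ?expr_le1//.
by rewrite opprB addrC subrK sqrtr_sqr ger0_norm.
Qed.
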